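(* Let $q\ge2$, let $\alpha_{\infty,1},\dots,\alpha_{\infty,q}$ be distinct real numbers, let $N_1,\dots,N_q$ be i.i.d. standard normal random variables, and let $F_\infty=\sum_{i=1}^q\alpha_{\infty,i}(N_i^2-1)$. Let $\mathcal{A}_\infty$ be the differential operator of order $q$ associated with $F_\infty$, acting on $f\in C^q(\mathbb{R})$ by $$\mathcal{A}_\infty f(x)=\sum_{l=2}^{q+1}(b_l-a_{l-1}x)f^{(q+2-l)}(x)-a_{q+1}xf(x),$$ with the coefficients $a_l,b_l$ defined in the context. Let $F$ be a centered random variable living in a finite sum of Wiener chaoses of an isonormal Gaussian process. Then $F$ and $F_\infty$ have the same law if and only if $\mathbb{E}[\mathcal{A}_\infty f(F)]=0$ for all $f\in C^q(\mathbb{R})$, $f:\mathbb{R}\to\mathbb{R}$, such that $\mathbb{E}[|\mathcal{A}_\infty f(F)|]<\infty$ and $\mathbb{E}[f^{(q)}(F)^2]<+\infty$.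
   Context: Let $X=\{X(h):h\in\mathfrak{H}\}$ be an isonormal Gaussian process over a real separable Hilbert space $\mathfrak{H}$; ''$F$ lives in a finite sum of Wiener chaoses'' means that $F$ belongs to the direct sum of finitely many Wiener chaoses of $X$. Write $\kappa_r(\cdot)$ for the $r$-th cumulant. Put $P(x)=x\prod_{i=1}^q(x-\alpha_{\infty,i})$, a polynomial of degree $q+1$, and define $$a_l=\frac{P^{(l)}(0)}{l!\,2^{l-1}}\quad(1\le l\le q+1),\qquad b_l=\sum_{r=l}^{q+1}\frac{a_r}{(r-l+1)!}\,\kappa_{r-l+2}(F_\infty)\quad(2\le l\le q+1).$$ *)

(* Defs.v *)
From HB Require Import structures.
From mathcomp Require Import all_boot all_order all_algebra.
From mathcomp Require Import all_classical all_reals all_analysis.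

Set Implicit Arguments.
Unset Strict Implicit.
Unset Printing Implicit Defensive.

Import Order.TTheory GRing.Theory Num.Theory.
Import numFieldNormedType.Exports.

Local Open Scope classical_set_scope.
Local Open Scope ring_scope.

(** The library has inner products ([{dot H for idfun}]) and complete normed
    spaces, but no Hilbert spaces: the norm has to be tied to the form. *)
Definition separable_hilbert (R : realType) (H : completeNormedModType R)
    (dot : {dot H for idfun}) : Prop :=
  (forall h : H, `|h| ^+ 2 = dot h h) /\
  (exists D : set H, countable D /\ dense D).

(** [normal_prob m 0] is the uniform law on [0, 1] in the library, hence the
    separate degenerate case. *)
Definition gaussian_law (R : realType) (m s : R) (A : set R) : \bar R :=
  if s == 0 then \d_m A else normal_prob m s A.

Definition isonormal (R : realType) (H : completeNormedModType R)
    (dot : {dot H for idfun}) (d : measure_display) (T : measurableType d)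
    (P : probability T R) (X : H -> {RV P >-> R}) : Prop :=
  (forall (n : nat) (c : 'I_n -> R) (h : 'I_n -> H), exists s : R,
     forall A : set R, measurable A ->
       P ((fun w => \sum_(i < n) c i * X (h i) w) @^-1` A)
       = gaussian_law 0 s A) /\
  (forall g h : H, ('E_P[X g \* X h] = (dot g h)%:E)%E).

(** Probabilists' Hermite polynomials:
    [H_n(x) = (-1)^n exp(x^2/2) (d/dx)^n exp(-x^2/2)], so that
    [H_n.+1 = 'X H_n - H_n']. *)
Fixpoint hermite (R : realType) (n : nat) : {poly R} :=
  if n is m.+1 then 'X * hermite R m - (hermite R m)^`() else 1.

Definition L2_closed_span (R : realType) (d : measure_display)
    (T : measurableType d) (P : probability T R) (S : set (T -> R)) :
    set (T -> R) :=
  [set Y | Y \in Lfun P 2%:E /\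
    forall e : R, 0 < e ->
      exists (n : nat) (c : 'I_n -> R) (Z : 'I_n -> T -> R),
        (forall i, S (Z i)) /\
        ('N[P]_2%:E[EFin \o (fun w => Y w - \sum_(i < n) c i * Z i w)%R]
           < e%:E)%E].

(** For [n = 0] the norm condition is dropped, so that the chaos of order 0 is
    the space of constants even when [H] is the null space. *)
Definition wiener_chaos (R : realType) (H : completeNormedModType R)
    (d : measure_display) (T : measurableType d) (P : probability T R)
    (X : H -> {RV P >-> R}) (n : nat) : set (T -> R) :=
  L2_closed_span P
    [set Z | exists h : H, (n = 0%N \/ `|h| = 1) /\
                           Z = (fun w => (hermite R n).[X h w])].

Definition in_finite_chaos (R : realType) (H : completeNormedModType R)
    (d : measure_display) (T : measurableType d) (P : probability T R)
    (X : H -> {RV P >-> R}) (F : {RV P >-> R}) : Prop :=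
  exists (m : nat) (Y : nat -> T -> R),
    (forall n, (n < m)%N -> wiener_chaos X n (Y n)) /\
    {ae P, forall w, F w = \sum_(n < m) Y n w}.

Definition mutually_independent (R : realType) (d : measure_display)
    (T : measurableType d) (P : probability T R) (q : nat)
    (N : 'I_q -> {RV P >-> R}) : Prop :=
  forall (J : {set 'I_q}) (B : 'I_q -> set R),
    (forall i, measurable (B i)) ->
    P (\bigcap_(i in [set` J]) (N i @^-1` B i))
    = (\prod_(i in J) P (N i @^-1` B i))%E.

Definition iid_std_normal (R : realType) (d : measure_display)
    (T : measurableType d) (P : probability T R) (q : nat)
    (N : 'I_q -> {RV P >-> R}) : Prop :=
  mutually_independent N /\
  (forall i (A : set R), measurable A ->
     distribution P (N i) A = normal_prob 0 1 A).

Definition quad_target (R : realType) (d : measure_display)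
    (T : measurableType d) (q : nat) (alpha : 'I_q -> R)
    (N : 'I_q -> {mfun T >-> R}) (w : T) : R :=
  \sum_(i < q) alpha i * (N i w ^+ 2 - 1).

Section quad_target_measurable.
Context (R : realType) (d : measure_display) (T : measurableType d) (q : nat).
Variables (alpha : 'I_q -> R) (N : 'I_q -> {mfun T >-> R}).

Lemma measurable_quad_target : measurable_fun setT (quad_target alpha N).
Proof.
apply: measurable_sum => i; apply: measurable_realfun.measurable_funM => //.
by apply: measurable_realfun.measurable_funB => //; exact: measurable_realfun.measurable_funX.
Qed.

HB.instance Definition _ :=
  isMeasurableFun.Build _ _ _ _ (quad_target alpha N) measurable_quad_target.

End quad_target_measurable.

(** Cumulants as derivatives at 0 of the cumulant generating function; this is
    meaningful for laws whose moment generating function is finite near 0. *)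
Definition cumulant (R : realType) (d : measure_display)
    (T : measurableType d) (P : probability T R) (Y : T -> R) (r : nat) : R :=
  derive1n r (fun t : R => ln (fine ('M_P Y t))) 0.

Definition stein_poly (R : realType) (q : nat) (alpha : 'I_q -> R) : {poly R} :=
  'X * \prod_(i < q) ('X - (alpha i)%:P).

Definition stein_a (R : realType) (q : nat) (alpha : 'I_q -> R) (l : nat) : R :=
  ((stein_poly alpha)^`(l)).[0] / (l`!%:R * 2 ^+ l.-1).

(** In what follows [kappa r] stands for the [r]-th cumulant of the target. *)
Definition stein_b (R : realType) (q : nat) (alpha : 'I_q -> R)
    (kappa : nat -> R) (l : nat) : R :=
  \sum_(l <= r < q.+2)
    stein_a alpha r / ((r - l + 1)`!)%:R * kappa (r - l + 2)%N.

Definition stein_op (R : realType) (q : nat) (alpha : 'I_q -> R)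
    (kappa : nat -> R) (f : R -> R) (x : R) : R :=
  \sum_(2 <= l < q.+2)
    (stein_b alpha kappa l - stein_a alpha l.-1 * x)
      * derive1n (q + 2 - l) f x
  - stein_a alpha q.+1 * x * f x.

Definition Ck (R : realType) (k : nat) (f : R -> R) : Prop :=
  (forall j x, (j < k)%N -> derivable (derive1n j f) x 1) /\
  continuous (derive1n k f).

(* Main.v *)
(** Put [A(X) = prod_j (1 - 2 alpha_j X)] and
    [B(X) = sum_i 2 alpha_i^2 X prod_(j != i) (1 - 2 alpha_j X)]. Inserting the
    cumulants [2^(r-1) (r-1)! sum_j alpha_j^r] of the target turns the Stein
    operator into [2^-q (B(D) f(x) - x A(D) f(x))].

    Necessity. Gaussian integration by parts in [N_i] gives
    [E[(N_i^2 - 1) g(F)] = 2 alpha_i E[N_i^2 g'(F)]], that is,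
    [E[(N_i^2 - 1) ((1 - 2 alpha_i D) g)(F)] = 2 alpha_i E[g'(F)]]. Take
    [g = prod_(j != i) (1 - 2 alpha_j D) f], multiply by [alpha_i] and sum over
    [i]. For integrability, [E[f^(q)(F)^2] < oo] and Fubini provide [rho] such
    that [x |-> f^(q)(alpha_i (x^2 - 1) + rho)] is square integrable for the
    Gaussian law, with [alpha_i] the largest (or the smallest) coefficient;
    integrating, [f^(k)(F)] is [O(exp(theta |N|^2))] for every [k < q] and every
    [theta > 1/4].

    Sufficiency. With [f = prod_j (1 + 2 alpha_j D) cos(xi . + c)] the
    hypothesis becomes a linear first-order differential equation for the
    characteristic function of [F], which the target satisfies as well by the
    necessity part; hence both characteristic functions agree. Averaging them
    against [exp(- eps xi)] gives the Cauchy kernel, whose primitive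
    [atan((y - x) / eps)] tends to a jump at [x] as [eps] tends to [0]. *)

From HB Require Import structures.
Require Import Defs.
From mathcomp Require Import all_boot all_order all_algebra.
From mathcomp Require Import all_classical all_reals all_analysis.
From mathcomp Require Import measurable_realfun.
From mathcomp Require Import ring lra zify.

Import Order.TTheory GRing.Theory Num.Theory.
Import numFieldNormedType.Exports.

Local Open Scope classical_set_scope.
Local Open Scope ring_scope.

Set Implicit Arguments.
Unset Strict Implicit.
Unset Printing Implicit Defensive.

(** * The Stein operator as a differential operator with linear coefficients *)

(** The rate 1/4 belongs to the square root of the Gaussian density: square integrability of a
    derivative along one coordinate controls the function at [n] only up to [phi(n) ^ (-1/2)], hence
    [exp(n^2/4)] up to polynomial factors. Integrability against the Gaussian law holds below rate
    1/2, and the gap pays for these factors. Extreme coefficients suffice because the quadratic form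
    lies between its smallest and its largest coefficient times [|x|^2]. The top derivative
    [f^(q)(F)] has no pointwise bound; being in L2 it can be paired with [N_i^2], but functions
    producing boundary terms must use derivatives below [q] only.

    In the converse, the characteristic function is carried by the real pair ([Ecos], [Esin]). On
    cosines the chosen factor turns [A(D)] into the scalar [|A(i xi)|^2 >= 1], so the differential
    equation has no singular coefficient. The test functions have bounded derivatives, so
    integrability of [F] is all that they require. The characteristic function of the target is
    never computed: uniqueness for a linear system with common value at 0 replaces it. Working with
    [atan] instead of its derivative avoids densities, and atoms are handled by a shift of the
    evaluation point. *)

Section symbol.
Context (R : realType).
Implicit Types (s : seq R) (p : {poly R}).

Lemma coef_linM (c : R) p k :
  ((1 - c *: 'X) * p)`_k = p`_k - (if k is j.+1 then c * p`_j else 0).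
Proof.
rewrite mulrBl mul1r coefB -scalerAl coefZ coefXM.
by case: k => [|k] //=; rewrite mulr0.
Qed.

(** Only an upper bound, since a factor with [c i = 0] does not raise the degree. The predicate lets
    it serve both the full product and the products with one factor left out. *)
Lemma size_prod_lin (I : Type) (r : seq I) (P : pred I) (c : I -> R) :
  (size (\prod_(i <- r | P i) (1 - c i *: 'X)%R)%R <= (count P r).+1)%N.
Proof.
elim: r => [|i r IH]; first by rewrite big_nil size_poly1.
rewrite big_cons /=; case: (P i) => //=.
apply/leq_sizeP => k; rewrite add1n => hk; rewrite coef_linM.
move/leq_sizeP: IH => IH; rewrite IH ?(leq_trans _ hk) //.
by case: k hk => [|k] // hk; rewrite IH // mulr0 subr0.
Qed.

(** The left product is the reciprocal polynomial of [\prod (X - a)] taken at [2 X]: both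
    coefficients are, up to powers of 2, the signed elementary symmetric function of degree [k]. *)
Lemma coef_prod_rev s k : (k <= size s)%N ->
  (\prod_(a <- s) (1 - (2 * a) *: 'X))`_k
  = 2 ^+ k * (\prod_(a <- s) ('X - a%:P))`_(size s - k).
Proof.
elim: s k => [|a s IH] k.
  by rewrite leqn0 => /eqP ->; rewrite !big_nil expr0 mul1r.
rewrite !big_cons /= => hk; rewrite coef_linM mulrBl coefB coefXM coefCM.
have [ek|nk] := eqVneq k (size s).+1.
  subst k; rewrite subnn /= nth_default; last first.
    by rewrite (leq_trans (size_prod_lin _ xpredT (fun x => 2 * x))) // count_predT.
  rewrite IH // subnn exprS; ring.
have {}hk : (k <= size s)%N by rewrite -ltnS ltn_neqAle nk.
rewrite subSn // /= IH //; case: k nk hk => [|k] nk hk.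
  rewrite subn0 subr0 (@nth_default _ _ _ (size s).+1) ?mulr0 ?subr0 //.
  by rewrite size_prod_XsubC.
rewrite IH ?(ltnW hk) // subnSK // exprS; ring.
Qed.

Variables (q : nat) (alpha : 'I_q -> R).

(* [2 ^ q A f x = symbolB(D) f x - x symbolA(D) f x], see [stein_opE]. *)
Definition symbolA : {poly R} := \prod_(j < q) (1 - (2 * alpha j) *: 'X).

Definition cosymbol (i : 'I_q) : {poly R} :=
  \prod_(j < q | j != i) (1 - (2 * alpha j) *: 'X).

Definition symbolB : {poly R} :=
  \sum_(i < q) (2 * alpha i ^+ 2) *: ('X * cosymbol i).

Lemma symbolAE i : symbolA = (1 - (2 * alpha i) *: 'X) * cosymbol i.
Proof. by rewrite /symbolA (bigD1 i). Qed.

Lemma size_symbolA : (size symbolA <= q.+1)%N.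
Proof.
rewrite (leq_trans (size_prod_lin _ xpredT (fun j => 2 * alpha j))) //.
by rewrite count_predT /index_enum -enumT size_enum_ord.
Qed.

Lemma size_cosymbol i : (size (cosymbol i) <= q)%N.
Proof.
rewrite (leq_trans (size_prod_lin _ (predC1 i) (fun j => 2 * alpha j))) //.
rewrite -[X in (_ < X)%N](size_enum_ord q) /index_enum -enumT.
by rewrite -(count_predC (pred1 i)) -add1n leq_add2r -has_count has_pred1 mem_enum.
Qed.

Lemma size_symbolB : (size symbolB <= q.+1)%N.
Proof.
apply: (leq_trans (size_sum _ _ _)); apply/bigmax_leqP => i _.
apply: (leq_trans (size_scale_leq _ _)).
rewrite (leq_trans (size_polyMleq _ _)) // size_polyX add2n /=.
by rewrite ltnS size_cosymbol.
Qed.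

(** The factor [X] of [stein_poly] shifts the index to [q - k]; the reversal then contributes
    [2^-k], which joins the [2^-(q-k)] in the definition of [stein_a]. *)
Lemma stein_a_symbol k : (k <= q)%N ->
  stein_a alpha (q.+1 - k) = 2 ^- q * symbolA`_k.
Proof.
move=> hk; rewrite /stein_a /symbolA.
have eA : forall (e : R -> {poly R}),
   \prod_(j < q) e (alpha j) = \prod_(a <- map alpha (enum 'I_q)) e a.
  by move=> e; rewrite big_map big_enum.
rewrite (eA (fun a => 1 - (2 * a) *: 'X)) coef_prod_rev; last first.
  by rewrite size_map size_enum_ord.
rewrite size_map size_enum_ord horner_coef0 coef_derivn addn0.
rewrite /stein_poly coefXM subSn //= (eA (fun a => 'X - a%:P)).
have h2 (n : nat) : (2 : R) ^+ n != 0 by rewrite expf_neq0 // pnatr_eq0.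
rewrite ffactnn -mulr_natr.
have hf : ((q - k).+1`!%:R : R) != 0 by rewrite pnatr_eq0 -lt0n fact_gt0.
have -> : (2 : R) ^- q = (2 ^+ (q - k) * 2 ^+ k)^-1 by rewrite -exprD subnK.
set c := _`_(q - k).
move: (h2 (q - k)%N) (h2 k) hf; set u := 2 ^+ _; set v := 2 ^+ _.
by set w := _%:R => hu hv hw; field; rewrite hu hv hw.
Qed.

(** As power series, [B = A * \sum_i 2 alpha_i^2 X / (1 - 2 alpha_i X)]; the right-hand side is the
    Cauchy product of [A] with the geometric series. *)
Lemma symbolB_coef k : (k < q)%N ->
  symbolB`_k.+1 = \sum_(s < k.+1) symbolA`_s *
     \sum_(i < q) 2 ^+ (k - s).+1 * alpha i ^+ (k - s).+2.
Proof.
move=> _; rewrite /symbolB coef_sum.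
under [RHS]eq_bigr do rewrite mulr_sumr.
rewrite exchange_big /=; apply: eq_bigr => i _.
rewrite coefZ coefXM /=.
(* Division of [A] by its factor [1 - 2 alpha_i X], done coefficient by coefficient by induction on
   [k]. *)
suff -> : (cosymbol i)`_k = \sum_(s < k.+1) symbolA`_s * (2 * alpha i) ^+ (k - s).
  rewrite mulr_sumr; apply: eq_bigr => s _.
  rewrite exprMn !exprS; ring.
elim: k => [|k IH].
  by rewrite big_ord_recl big_ord0 addr0 subnn expr0 mulr1 (symbolAE i) coef_linM subr0.
rewrite big_ord_recr /= subnn expr0 mulr1 [in symbolA`__](symbolAE i) coef_linM IH.
rewrite [X in _ = X + _](_ : _ = 2 * alpha i * \sum_(s < k.+1) symbolA`_s *
  (2 * alpha i) ^+ (k - s)).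
  by rewrite addrC subrK.
rewrite mulr_sumr; apply: eq_bigr => s _ /=.
by rewrite subSn ?leq_ord // exprS; ring.
Qed.

Lemma stein_b_symbol (kappa : nat -> R) k : (k < q)%N ->
  (forall m, kappa m.+2 = m.+1`!%:R * 2 ^+ m.+1 * \sum_(i < q) alpha i ^+ m.+2) ->
  stein_b alpha kappa (q.+1 - k) = 2 ^- q * symbolB`_k.+1.
Proof.
move=> hk kE; rewrite /stein_b symbolB_coef // mulr_sumr.
rewrite -{1}[(q.+1 - k)%N]add0n big_addn.
rewrite subSn; last by lia.
rewrite (_ : (q.+1 - (q.+1 - k) = k)%N); last by lia.
(* Reversal puts [r = q + 1 - s], so that [s] indexes the coefficients of [symbolA]; the factorial
   in [stein_b] then cancels the one in the cumulant. *)
rewrite big_nat_rev /= big_mkord; apply: eq_bigr => s _.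
have hs := leq_ord s.
have -> : (0 + k.+1 - s.+1 + (q.+1 - k) = q.+1 - s)%N by lia.
rewrite stein_a_symbol; last by lia.
have -> : (q.+1 - s - (q.+1 - k) = k - s)%N by lia.
rewrite addn1 addn2 kE -!mulrA; congr (_ * (_ * _)).
rewrite mulrA mulVf ?mul1r ?mulr_sumr //.
Qed.

End symbol.

Section differential_operator.
Context (R : realType).
Implicit Types (p : {poly R}) (f : R -> R).

(** The differential operator [p(D)] with constant coefficients and symbol [p]. *)
Definition dop p f (x : R) : R := \sum_(k < size p) p`_k * derive1n k f x.

Lemma dop_widen n p f x : (size p <= n)%N ->
  dop p f x = \sum_(k < n) p`_k * derive1n k f x.
Proof.
move=> hn; rewrite /dop (big_ord_widen n (fun k => p`_k * derive1n k f x) hn).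
rewrite [RHS](bigID (fun k : 'I_n => (k < size p)%N)) /= [X in _ + X]big1 ?addr0 //.
by move=> k; rewrite -leqNgt => hk; rewrite nth_default // mul0r.
Qed.

Lemma dopD p r f x : dop (p + r) f x = dop p f x + dop r f x.
Proof.
set n := maxn (size p) (size r).
rewrite !(@dop_widen n) ?leq_maxl ?leq_maxr ?size_polyD //.
by rewrite -big_split; apply: eq_bigr => k _; rewrite coefD mulrDl.
Qed.

Lemma dopZ c p f x : dop (c *: p) f x = c * dop p f x.
Proof.
rewrite !(@dop_widen (size p)) ?size_scale_leq // mulr_sumr.
by apply: eq_bigr => k _; rewrite coefZ mulrA.
Qed.

Lemma dopB p r f x : dop (p - r) f x = dop p f x - dop r f x.
Proof. by rewrite -scaleN1r dopD dopZ mulN1r. Qed.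

Lemma dop_sum (I : Type) (r : seq I) (p : I -> {poly R}) f x :
  dop (\sum_(i <- r) p i) f x = \sum_(i <- r) dop (p i) f x.
Proof.
elim: r => [|i r IH]; last by rewrite !big_cons dopD IH.
by rewrite !big_nil /dop size_poly0 big_ord0.
Qed.

Lemma stein_opE q (alpha : 'I_q -> R) (kappa : nat -> R) f x :
  (forall m, kappa m.+2 = m.+1`!%:R * 2 ^+ m.+1 * \sum_(i < q) alpha i ^+ m.+2) ->
  stein_op alpha kappa f x
  = 2 ^- q * (dop (symbolB alpha) f x - x * dop (symbolA alpha) f x).
Proof.
move=> kE; rewrite /stein_op.
rewrite !(@dop_widen q.+1) ?size_symbolA ?size_symbolB //.
rewrite !big_ord_recl /=.
(* Since [B] has no constant term, [f] itself enters only through [- x A(D) f], which accounts for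
   the isolated last term of [stein_op]. *)
have -> : (symbolB alpha)`_0 = 0.
  by rewrite /symbolB coef_sum big1 // => i _; rewrite coefZ coefXM mulr0.
rewrite mul0r add0r big_nat_rev /= -{1}[2%N]add0n big_addn.
rewrite (_ : (q.+2 - 2 = q)%N); last by lia.
rewrite big_mkord -[X in stein_a alpha X](subn0 q.+1) stein_a_symbol //.
under [X in X - _ = _]eq_bigr => k _.
  have hk := ltn_ord k.
  have -> : (2 + q.+2 - (k + 2).+1 = q.+1 - k)%N by lia.
  have -> : ((q.+1 - k).-1 = q.+1 - k.+1)%N by lia.
  rewrite stein_b_symbol // stein_a_symbol; last by lia.
  have -> : (q + 2 - (q.+1 - k) = k.+1)%N by lia.
  over.
rewrite /= mulrBr mulrDr mulrDr opprD addrA mulr_sumr.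
rewrite [in X in _ = _ - X - _](mulrC x).
rewrite [RHS]addrAC !mulr_sumr -sumrB; congr (_ - _); last by ring.
by apply: eq_bigr => k _; rewrite /bump !add1n add0n [derive1n _ _]/=; ring.
Qed.

End differential_operator.

(** * Independence and product measures *)

Section independence.
Context (R : realType) (d : measure_display) (T : measurableType d)
  (P : probability T R).

Section pair.
Variables (U V : {mfun T >-> R}).
Hypothesis indepUV : forall A B : set R, measurable A -> measurable B ->
  P (U @^-1` A `&` V @^-1` B) = (P (U @^-1` A) * P (V @^-1` B))%E.

Definition joint (w : T) : R * R := (U w, V w).

Lemma measurable_joint : measurable_fun setT joint.
Proof. exact: measurable_fun_pair. Qed.

HB.instance Definition _ := isMeasurableFun.Build _ _ _ _ joint measurable_joint.

(** Independence says that the two measures agree on rectangles, and rectangles determine the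
    product measure. *)
Lemma joint_distribution X : measurable X ->
  (distribution P U \x distribution P V)%E X = distribution P joint X.
Proof. by apply: product_measure_unique => A B mA mB; rewrite -indepUV. Qed.

Lemma ge0_integral_joint (f : R * R -> \bar R) :
  measurable_fun setT f -> (forall z, 0 <= f z)%E ->
  (\int[P]_w f (U w, V w) =
   \int[distribution P V]_v \int[distribution P U]_u f (u, v))%E.
Proof.
move=> mf f0.
rewrite -(@fubini_tonelli2 _ _ _ _ _ (distribution P U)
  (distribution P V) f) // -[LHS](ge0_integral_distribution joint mf f0).
by apply: eq_measure_integral => X mX _; exact/esym/joint_distribution.
Qed.

Lemma integrable_joint (f : R * R -> \bar R) :
  measurable_fun setT f -> P.-integrable setT (fun w => f (U w, V w)) ->
  (distribution P U \x distribution P V)%E.-integrable setT f.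
Proof.
move=> mf intf.
have : (distribution P joint).-integrable setT f.
  by apply: integrable_pushforward => //; exact: measurable_joint.
move=> /integrableP[_ h]; apply/integrableP; split => //.
rewrite (eq_measure_integral (distribution P joint)) // => X mX _.
exact: joint_distribution.
Qed.

Lemma integral_joint (f : R * R -> \bar R) :
  measurable_fun setT f -> P.-integrable setT (fun w => f (U w, V w)) ->
  (\int[P]_w f (U w, V w) =
   \int[distribution P V]_v \int[distribution P U]_u f (u, v))%E.
Proof.
move=> mf intf.
rewrite (@integral21_prod_meas1 _ _ _ _ _ (distribution P U) (distribution P V) f);
  last first.
  exact: integrable_joint.
rewrite -[LHS](integral_distribution (X := joint) mf intf).
by apply: eq_measure_integral => X mX _; exact/esym/joint_distribution.
Qed.

End pair.

Section family.
Variables (q : nat) (N : 'I_q -> {RV P >-> R}).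
Hypothesis indepN : mutually_independent N.

(** These sets are stable under intersection and generate the sigma-algebra of the coordinates in
    [J]. *)
Definition cylinders (J : {set 'I_q}) : set (set T) :=
  [set S | exists B : 'I_q -> set R, (forall i, measurable (B i)) /\
     S = \bigcap_(i in [set` J]) (N i @^-1` B i)].

Lemma cylinders_sub J : cylinders J `<=` measurable.
Proof.
move=> _ [B [mB ->]]; apply: fin_bigcap_measurable => // i _.
by rewrite -[X in measurable X]setTI; exact: measurable_funP.
Qed.

(** For fixed [A] both sides are finite measures in [S]. They agree on cylinders by mutual
    independence, hence on the generated sigma-algebra. *)
Lemma indep_cylinders (i : 'I_q) (J : {set 'I_q}) (A : set R) (S : set T) :
  i \notin J -> measurable A -> <<s cylinders J >> S ->
  P (N i @^-1` A `&` S) = (P (N i @^-1` A) * P S)%E.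
Proof.
move=> iJ mA SJ.
have mNA : measurable (N i @^-1` A).
  by rewrite -[X in measurable X]setTI; exact: measurable_funP.
have pA0 : (0 <= fine (P (N i @^-1` A)))%R by rewrite fine_ge0.
pose m1 : {measure set T -> \bar R} := mrestr P mNA.
pose m2 : {measure set T -> \bar R} := mscale (NngNum pA0) P.
have -> : P (N i @^-1` A `&` S) = m1 S by rewrite /m1 /mrestr setIC.
have -> : (P (N i @^-1` A) * P S)%E = m2 S.
  by rewrite /m2 /= /mscale /= fineK // fin_num_measure.
apply: (@g_sigma_algebra_measure_unique _ R T (cylinders J) _ (fun=> setT)) => //.
- exact: cylinders_sub.
- move=> _; exists (fun=> setT); split => //.
  by rewrite bigcapT // => *; rewrite preimage_setT.
- by rewrite bigcup_const //; exists 0%N.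
- move=> _ _ [B [mB ->]] [C [mC ->]].
  exists (fun j => B j `&` C j); split; first by move=> j; exact: measurableI.
  by rewrite -bigcapI; apply: eq_bigcapr => j _; rewrite preimage_setI.
- move=> _ [B [mB ->]]; rewrite /m1 /m2 /= /mrestr /mscale /= setIC.
  (* Because [i] is outside [J], the event on [N i] and the cylinder over [J] form one cylinder over
     [i |: J]. *)
  pose B' j := if j == i then A else B j.
  have mB' j : measurable (B' j) by rewrite /B'; case: ifP.
  have neq j : j \in J -> j == i = false.
    by move=> jJ; apply/negbTE; apply: contraNneq iJ => <-.
  rewrite indepN // fineK ?fin_num_measure //.
  have := indepN (i |: J) mB'.
  have -> : A = B' i by rewrite /B' eqxx.
  rewrite big_setU1 //=.
  under eq_bigr => j jJ do rewrite /B' neq //.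
  move=> <-; congr (P _); apply/seteqP; split => [w [wA wB] j|w wB].
    rewrite /= !inE => /orP[/eqP -> //|jJ].
    by rewrite /B' neq //; exact: wB.
  split; first by have := wB i; rewrite /= !inE eqxx; exact.
  by move=> j /= jJ; have := wB j; rewrite /= !inE jJ orbT /B' neq //; exact.
- by move=> _; rewrite /m1 /= /mrestr setTI -ge0_fin_numE // fin_num_measure.
Qed.

Lemma cylinders_coord (J : {set 'I_q}) j : j \in J ->
  measurable_fun (setT : set (g_sigma_algebraType (cylinders J))) (N j).
Proof.
move=> jJ _ A mA; rewrite setTI; apply: sub_sigma_algebra.
exists (fun k => if k == j then A else setT); split; first by move=> k; case: ifP.
apply/seteqP; split => [w wA k _|w]; first by case: eqP => [->|].
by move=> /(_ j); rewrite eqxx; apply.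
Qed.

Lemma indep_coord (i : 'I_q) (J : {set 'I_q}) (V : T -> R) :
  i \notin J ->
  measurable_fun (setT : set (g_sigma_algebraType (cylinders J))) V ->
  forall A B : set R, measurable A -> measurable B ->
  P (N i @^-1` A `&` V @^-1` B) = (P (N i @^-1` A) * P (V @^-1` B))%E.
Proof.
move=> iJ mV A B mA mB; apply: indep_cylinders iJ mA _.
by have := mV measurableT B mB; rewrite setTI.
Qed.

Lemma expectation_prod_indep (g : 'I_q -> R -> R) :
  (forall i, measurable_fun setT (g i)) -> (forall i x, 0 <= g i x) ->
  (\int[P]_w (\prod_(i < q) g i (N i w))%:E
   = \prod_(i < q) \int[distribution P (N i)]_x (g i x)%:E)%E.
Proof.
move=> mg g0.
have mN i (J : {set 'I_q}) : i \in J ->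
    measurable_fun (setT : set (g_sigma_algebraType (cylinders J))) (fun w => g i (N i w)).
  by move=> iJ; apply: measurableT_comp => //; exact: cylinders_coord.
have mp (s : seq 'I_q) (J : {set 'I_q}) : {subset s <= J} ->
    measurable_fun (setT : set (g_sigma_algebraType (cylinders J)))
      (fun w => \prod_(i <- s) g i (N i w)).
  by move=> sJ; apply: measurable_prod => i /sJ; exact: mN.
have mpT (s : seq 'I_q) : measurable_fun setT (fun w => \prod_(i <- s) g i (N i w)).
  by apply: measurable_prod => i _; apply: measurableT_comp => //; exact: measurable_funP.
suff : forall s : seq 'I_q, uniq s ->
    (\int[P]_w (\prod_(i <- s) g i (N i w))%:E
   = \prod_(i <- s) \int[distribution P (N i)]_x (g i x)%:E)%E.
  by apply; rewrite /index_enum -enumT enum_uniq.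
elim=> [_|i s IH /=/andP[iNs us]].
  rewrite big_nil; under eq_integral do rewrite big_nil.
  by rewrite integral_cst // mul1e; exact: probability_setT.
rewrite big_cons -IH //.
pose V := fun w => \prod_(j <- s) g j (N j w).
pose V' : {mfun T >-> R} := HB.pack V (isMeasurableFun.Build _ _ _ _ V (mpT s)).
have iJ : i \notin [set j in s] by rewrite inE.
have mVJ : measurable_fun (setT : set (g_sigma_algebraType (cylinders [set j in s]))) V'.
  by apply: mp => j js; rewrite inE.
have V0 w : 0 <= V w by exact: prodr_ge0.
(* Tonelli needs an integrand that is nonnegative on the whole plane; the absolute value changes
   nothing along the values of [V]. *)
pose f (z : R * R) := (g i z.1 * `|z.2|)%:E.
transitivity (\int[P]_w f (N i w, V' w))%E.
  by apply: eq_integral => w _; rewrite big_cons /f /= ger0_norm.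
have mabs : measurable_fun [set: R] (fun v : R => (`|v|)%:E).
  by apply/measurable_EFinP; exact: (measurableT_comp (@normr_measurable R _)).
rewrite (ge0_integral_joint (indep_coord iJ mVJ)); last 2 first.
- apply/measurable_EFinP; apply: measurable_funM.
    exact: measurableT_comp.
  by apply: measurableT_comp.
- by move=> z; rewrite lee_fin mulr_ge0.
under eq_integral => v _.
  rewrite /f /=; under eq_integral do rewrite EFinM.
  rewrite ge0_integralZr //; last 2 first.
  - exact/measurable_EFinP.
  - by move=> x _; rewrite lee_fin.
  over.
rewrite ge0_integralZl // ?integral_ge0 //; last by move=> x _; rewrite lee_fin.
congr (_ * _)%E; rewrite (ge0_integral_distribution V' mabs) //.
by apply: eq_integral => w _ /=; rewrite ger0_norm.
Qed.

End family.
End independence.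

(** * Calculus on the real line *)

Section calculus.
Context (R : realType).
Notation mu := (@lebesgue_measure R).
Implicit Types F G f g : R -> R.

Lemma is_derive_continuous F f : (forall x : R, is_derive x (1 : R) F
  (f x)) -> continuous F.
Proof.
by move=> dF x; apply/differentiable_continuous/derivable1_diffP; case: (dF x).
Qed.

Lemma is_derive_add F G (x a b : R) : is_derive x (1 : R) F a -> is_derive x (1 : R) G b ->
  is_derive x (1 : R) (fun y => F y + G y) (a + b).
Proof. by move=> hF hG; apply: is_deriveD. Qed.

Lemma is_derive_mul F G (x a b : R) : is_derive x (1 : R) F a -> is_derive x (1 : R) G b ->
  is_derive x (1 : R) (fun y => F y * G y) (a * G x + F x * b).
Proof.
move=> hF hG; apply: (@is_derive_eq _ _ _ _ _ _ _ _ (is_deriveM hF hG)).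
by rewrite addrC /GRing.scale /= mulrC.
Qed.

Lemma is_derive_scale c F (x a : R) : is_derive x (1 : R) F a ->
  is_derive x (1 : R) (fun y => c * F y) (c * a).
Proof.
move=> hF; apply: (@is_derive_eq _ _ _ _ _ _ _ _ (is_derive_mul (is_derive_cst c x 1) hF)).
by rewrite mul0r add0r.
Qed.

Lemma is_derive_square (x : R) : is_derive x (1 : R) (fun y => y ^+ 2) (2 * x).
Proof.
have h := is_derive_id x (1 : R); apply: (@is_derive_eq _ _ _ _ _ _ _ _
  (is_derive_mul h h)).
by rewrite mul1r mulr1 mulr2n mulrDl mul1r.
Qed.

Lemma is_derive_affine (a b x : R) : is_derive x (1 : R) (fun y => a * y + b) a.
Proof.
apply: (@is_derive_eq _ _ _ _ _ _ _ _ (is_derive_add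
  (is_derive_scale a (is_derive_id x (1 : R))) (is_derive_cst b x 1))).
by rewrite mulr1 addr0.
Qed.

Lemma continuous_bounded_itv f a b : continuous f ->
  exists C, 0 <= C /\ forall x, a <= x <= b -> `|f x| <= C.
Proof.
move=> cf; have [ab|ba] := leP a b; last first.
  by exists 0; split => // x /andP[ax xb]; have := le_trans ax xb; rewrite leNgt ba.
have cn : {within `[a, b], continuous (fun x => `|f x|)}.
  by apply: continuous_subspaceT => x; apply: continuous_comp (cf x) _;
    exact: norm_continuous.
have [c _ hc] := EVT_max ab cn; exists `|f c|; split => // x xab.
Qed.

Lemma continuous_mul f g : continuous f -> continuous g ->
  continuous (fun x => f x * g x).
Proof. by move=> cf cg x; apply: cvgM; [exact: cf|exact: cg]. Qed.

Lemma continuous_add f g : continuous f -> continuous g ->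
  continuous (fun x => f x + g x).
Proof. by move=> cf cg x; apply: cvgD; [exact: cf|exact: cg]. Qed.

Lemma continuous_const (c : R) : continuous (fun _ : R => c).
Proof. by move=> x; exact: cvg_cst. Qed.

Lemma continuous_square f : continuous f -> continuous (fun x => f x ^+ 2).
Proof. by move=> cf x; apply: (continuous_mul cf cf). Qed.

Lemma continuous_measurable f : continuous f -> measurable_fun setT f.
Proof. exact: continuous_measurable_fun. Qed.

Lemma FTC_itv F f a b : (forall x : R, is_derive x (1 : R) F
  (f x)) -> continuous f -> a <= b ->
  (\int[mu]_(x in `[a, b]) (f x)%:E = (F b - F a)%:E)%E.
Proof.
move=> dF cf; rewrite le_eqVlt => /orP[/eqP ->|ab].
  by rewrite subrr set_itv1 integral_set1.
have cF := is_derive_continuous dF.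
rewrite (continuous_FTC2 (F := F)) ?EFinB //.
- by apply: continuous_subspaceT.
- split; first by move=> x _; case: (dF x).
    exact/cvg_at_right_filter/cF.
  exact/cvg_at_left_filter/cF.
- by move=> x _; rewrite derive1E; case: (dF x).
Qed.

(** Dominated convergence for [f] cut off to [D n], with majorant [|f|]. *)
Lemma cvg_integral_bigcup (f : R -> R) (D : nat -> set R) (E : set R) :
  (forall n, measurable (D n)) -> measurable E ->
  (forall n, D n `<=` E) -> (forall x, E x -> \forall n \near \oo, D n x) ->
  mu.-integrable E (EFin \o f) ->
  (\int[mu]_(x in D n) (f x)%:E @[n --> \oo] --> \int[mu]_(x in E) (f x)%:E)%E.
Proof.
move=> mD mE DE cD intf.
have [mf _] := integrableP _ _ _ intf.
have -> : (fun n => \int[mu]_(x in D n) (f x)%:E)%E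
  = (fun n => \int[mu]_(x in E) ((EFin \o f) \_ (D n)) x)%E.
  apply/funext => n; rewrite -[X in integral _ X _](setIidr (DE n)).
  by rewrite integral_mkcondr.
have [] := @dominated_convergence _ _ _ mu E mE
  (fun n => (EFin \o f) \_ (D n)) (EFin \o f) (abse \o (EFin \o f)).
- by move=> n; apply/measurable_restrict; [exact: mD|exact: mE|exact: (measurable_funS mE
  (@subIsetl _ _ _) mf)].
- by [].
- apply: aeW => x Ex; apply: cvg_near_cst; apply: filterS (cD x Ex) => n Dn.
  by rewrite patchE mem_set.
- exact: integrable_abse.
- by apply: aeW => x n _; rewrite patchE; case: ifP => _ //=; rewrite normr0 lee_fin.
- by [].
Qed.

Lemma FTC_line F f : (forall x : R, is_derive x (1 : R) F (f x)) -> continuous f ->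
  mu.-integrable setT (EFin \o f) ->
  F x @[x --> +oo] --> 0 -> F x @[x --> -oo] --> 0 ->
  (\int[mu]_x (f x)%:E = 0)%E.
Proof.
move=> dF cf intf Fy FNy.
have h : (\int[mu]_(x in `[(- n%:R)%R, n%:R%R]) (f x)%:E @[n --> \oo] --> \int[mu]_x
  (f x)%:E)%E.
  apply: cvg_integral_bigcup => // x _.
  near=> n; rewrite /= in_itv /= -ler_norml; near: n; exact: nbhs_infty_ger.
apply/esym; apply: (cvg_unique _ _ h) => //.
have -> : (fun n : nat => \int[mu]_(x in `[(- n%:R)%R, n%:R%R]) (f x)%:E)%E
  = EFin \o (fun n : nat => F n%:R - F (- n%:R)).
  by apply/funext => n; rewrite (FTC_itv dF) // ge0_cp.
apply/cvg_EFin; first exact: nearW.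
rewrite -[X in _ --> X](subrr 0); apply: cvgB.
  exact: (cvg_comp _ _ cvgr_idn Fy).
apply: (cvg_comp _ _ _ FNy).
by apply/cvgNrNy; exact: cvgr_idn.
Unshelve. all: by end_near. Qed.

Lemma FTC_halfline F f l : (forall x : R, is_derive x (1 : R) F (f x)) -> continuous f ->
  mu.-integrable `[0, +oo[ (EFin \o f) -> F x @[x --> +oo] --> l ->
  (\int[mu]_(x in `[0%R, +oo[) (f x)%:E = (l - F 0)%:E)%E.
Proof.
move=> dF cf intf Fy.
have h : (\int[mu]_(x in `[0%R, n%:R%R]) (f x)%:E @[n --> \oo] -->
          \int[mu]_(x in `[0%R, +oo[) (f x)%:E)%E.
  apply: cvg_integral_bigcup => // [n x|x].
    by rewrite /= !in_itv /= => /andP[->].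
  rewrite /= in_itv /= andbT => x0.
  near=> n; rewrite /= in_itv /= x0 /=; near: n; exact: nbhs_infty_ger.
apply: (cvg_unique _ h) => //.
have -> : (fun n : nat => \int[mu]_(x in `[0%R, n%:R%R]) (f x)%:E)%E
  = EFin \o (fun n : nat => F n%:R - F 0).
  by apply/funext => n; rewrite (FTC_itv dF).
apply/cvg_EFin; first exact: nearW.
apply: cvgB; last exact: cvg_cst.
exact: (cvg_comp _ _ cvgr_idn Fy).
Unshelve. all: by end_near. Qed.

End calculus.

(** * Gaussian integrals *)

Section gaussian.
Context (R : realType).
Notation mu := (@lebesgue_measure R).
Notation gamma := (normal_prob (0 : R) 1).
Notation phi := (normal_pdf (0 : R) 1).
Implicit Types f h : R -> R.

Lemma gauss_pdfE x : phi x = normal_peak 1 * expR (- (x ^+ 2 / 2)).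
Proof.
by rewrite normal_pdfE ?oner_neq0 // /normal_fun subr0 expr1n mulNr.
Qed.

Lemma ge0_integral_gauss f : measurable_fun setT f -> (forall x, 0 <= f x) ->
  (\int[gamma]_x (f x)%:E = \int[mu]_x (f x * phi x)%:E)%E.
Proof.
move=> mf f0.
have dom : gamma `<< mu by exact: normal_prob_dominates.
rewrite -(Radon_Nikodym_SigmaFinite.change_of_variables dom) //;
  last exact/measurable_EFinP.
set g := Radon_Nikodym_SigmaFinite.f _ _.
have intg : mu.-integrable setT g by exact: Radon_Nikodym_SigmaFinite.f_integrable.
apply: ae_eq_integral => //.
- apply: emeasurable_funM; first exact/measurable_EFinP.
  exact: measurable_int intg.
- by apply/measurable_EFinP/measurable_funM => //; exact: measurable_normal_pdf.
(* Both functions integrate to [gamma E] over every measurable [E], which identifies them up to a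
   null set. *)
have : ae_eq mu setT g (EFin \o phi).
  apply: integral_ae_eq => //.
  - by apply/measurable_EFinP; exact: measurable_normal_pdf.
  - by move=> E _ mE; rewrite -Radon_Nikodym_SigmaFinite.f_integral.
by apply: filterS => x /= h xT; rewrite h // EFinM.
Qed.

Lemma integrable_gauss f : measurable_fun setT f ->
  gamma.-integrable setT (EFin \o f) ->
  mu.-integrable setT (EFin \o (fun x => f x * phi x)).
Proof.
move=> mf /integrableP[_ intf]; apply/integrableP; split.
  by apply/measurable_EFinP/measurable_funM => //; exact: measurable_normal_pdf.
apply: le_lt_trans intf.
rewrite (ge0_integral_gauss (f := fun x => `|f x|)) //.
  by under eq_integral do rewrite /= normrM (ger0_norm (normal_pdf_ge0 _ _ _)).
exact: measurableT_comp.
Qed.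

Lemma integral_gauss f : measurable_fun setT f ->
  gamma.-integrable setT (EFin \o f) ->
  (\int[gamma]_x (f x)%:E = \int[mu]_x (f x * phi x)%:E)%E.
Proof.
move=> mf intf; rewrite integralE [RHS]integralE.
have phi0 x : 0 <= phi x := normal_pdf_ge0 0 1 x.
have mp (g : R -> R) : measurable_fun setT g -> measurable_fun setT (fun x => Num.max
  (g x) 0).
  by move=> mg; apply: measurable_maxr.
congr (_ - _)%E.
- transitivity (\int[gamma]_x (Num.max (f x) 0)%:E)%E.
    by apply: eq_integral => x _; rewrite funeposE EFin_max.
  rewrite ge0_integral_gauss //; [|exact: mp|by move=> x; rewrite le_max lexx orbT].
  apply: eq_integral => x _; rewrite funeposE -EFin_max; congr EFin.
  by rewrite maxr_pMl // mul0r.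
- transitivity (\int[gamma]_x (Num.max (- f x) 0)%:E)%E.
    by apply: eq_integral => x _; rewrite funenegE EFin_max EFinN.
  rewrite ge0_integral_gauss //; last 2 first.
  + by apply: mp; exact: measurable_funN.
  + by move=> x; rewrite le_max lexx orbT.
  apply: eq_integral => x _; rewrite funenegE -EFinN -EFin_max; congr EFin.
  by rewrite maxr_pMl // mul0r mulNr.
Qed.

(** The integrand times the standard density is [t] times the centred normal density of variance
    [t^2 = 1 / (1 - 2 s)]. *)
Lemma gauss_square_mgf (s : R) : s < 1 / 2 ->
  (\int[gamma]_x (expR (s * x ^+ 2))%:E = (Num.sqrt (1 - 2 * s))^-1%:E)%E.
Proof.
move=> hs; have hs0 : 0 < 1 - 2 * s by lra.
rewrite ge0_integral_gauss; last 2 first.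
- apply: continuous_measurable => x; apply: continuous_comp; last exact: continuous_expR.
  by apply: continuousM; [exact: cst_continuous|exact: exprn_continuous].
- by move=> x; exact: expR_ge0.
set t := (Num.sqrt (1 - 2 * s))^-1.
have t0 : t != 0 by rewrite invr_eq0 gt_eqF // sqrtr_gt0.
have t2 : t ^+ 2 = (1 - 2 * s)^-1 by rewrite exprVn sqr_sqrtr // ltW.
transitivity (\int[mu]_x (t%:E * (normal_pdf 0 t x)%:E))%E; last first.
  rewrite integralZl //; last exact: integrable_normal_pdf.
  by rewrite integral_normal_pdf mule1.
apply: eq_integral => x _; rewrite -EFinM; congr EFin.
rewrite gauss_pdfE normal_pdfE // /normal_fun subr0 mulrCA -expRD [RHS]mulrA.
congr (_ * expR _); last first.
  rewrite t2 -mulr_natr; field; lra.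
rewrite /normal_peak expr1n mul1r -mulrnAr sqrtrM ?sqr_ge0 // sqrtr_sqr.
by rewrite ger0_norm ?invr_ge0 ?sqrtr_ge0 // invfM mulrA divff // mul1r.
Qed.

End gaussian.

(** * Gaussian integration by parts on the line *)

Section gaussian_ibp.
Context (R : realType).
Notation mu := (@lebesgue_measure R).
Notation gamma := (normal_prob (0 : R) 1).
Notation phi := (normal_pdf (0 : R) 1).
Implicit Types g h : R -> R.

Lemma continuous_gauss_pdf : continuous phi.
Proof. by apply: continuous_normal_pdf; exact: oner_neq0. Qed.

Lemma is_derive_gauss_pdf (x : R) : is_derive x (1 : R) phi (- x * phi x).
Proof.
have -> : phi = (fun y => normal_peak 1 * (expR \o (fun y => - (1 / 2) * y ^+ 2)) y).
  by apply/funext => y; rewrite gauss_pdfE /=; congr (_ * expR _); field.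
apply: (@is_derive_eq _ _ _ _ _ _ _ _ (is_derive_scale _
  (is_derive1_comp (is_derive_expR _) (is_derive_scale _ (is_derive_square x))))).
by rewrite /=; field.
Qed.

(** With [u = d x^2], [exp(u) = exp(u/2)^2 >= (1 + u/2)^2 >= u^2/4]. *)
Lemma expR_quad_ub (d x : R) : 0 < d -> d ^+ 2 * x ^+ 4 / 4 <= expR (d * x ^+ 2).
Proof.
move=> d0; have -> : d * x ^+ 2 = d * x ^+ 2 / 2 + d * x ^+ 2 / 2 by field.
rewrite expRD; have h := expR_ge1Dx (d * x ^+ 2 / 2).
have h0 : 0 <= d * x ^+ 2 / 2 by rewrite divr_ge0 // mulr_ge0 ?sqr_ge0 // ltW.
have hp : 0 <= 1 + d * x ^+ 2 / 2 by lra.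
apply: le_trans (ler_pM hp hp h h).
have -> : x ^+ 4 = x ^+ 2 * x ^+ 2 by rewrite -exprD.
rewrite [X in X <= _](_ : _ = (d * x ^+ 2 / 2) * (d * x ^+ 2 / 2)); last by field.
by move: h0; set u := d * _ / 2 => h0; nra.
Qed.

(** A rate below 1/2 leaves [exp(- d x^2)] with [d = 1/2 - theta], and [exp(d x^2) >= d x^2] bounds
    [|x| exp(- d x^2)] by [1 / (d |x|)]. This kills the boundary terms of [gauss_ibp]. *)
Lemma gauss_tail (C theta : R) (h : R -> R) : theta < 1 / 2 ->
  (forall x, `|h x| <= C * expR (theta * x ^+ 2)) ->
  exists D, forall x, 0 < `|x| -> `|x * phi x * h x| <= D / `|x|.
Proof.
move=> ht hb; pose d := 1 / 2 - theta.
have d0 : 0 < d by rewrite /d; lra.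
have c0 : 0 <= @normal_peak R 1 by exact: normal_peak_ge0.
exists (normal_peak 1 * C / d) => x x0.
rewrite !normrM (ger0_norm (normal_pdf_ge0 _ _ _)) gauss_pdfE.
apply: (@le_trans _ _ (`|x| * (normal_peak 1 * expR (- (x ^+ 2 / 2))) * (C * expR
  (theta * x ^+ 2)))).
  by rewrite ler_wpM2l // !mulr_ge0 // expR_ge0.
have -> : `|x| * (normal_peak 1 * expR (- (x ^+ 2 / 2))) * (C * expR (theta * x ^+ 2)) =
  normal_peak 1 * C * (`|x| * expR (- (d * x ^+ 2))).
  have -> : - (d * x ^+ 2) = - (x ^+ 2 / 2) + theta * x ^+ 2 by rewrite /d; field.
  by rewrite expRD; ring.
rewrite -!mulrA; apply: ler_wpM2l => //.
have C0 : 0 <= C by have := hb 0; rewrite expr0n mulr0 expR0 mulr1; apply: le_trans.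
apply: ler_wpM2l => //.
rewrite expRN -invfM ler_pdivrMr ?expR_gt0 //.
rewrite mulrC ler_pdivlMr ?mulr_gt0 //.
apply: le_trans (_ : d * x ^+ 2 <= _).
  by rewrite -(real_normK (num_real x)); lra.
have := expR_ge1Dx (d * x ^+ 2); lra.
Qed.

(** Since [(x phi)' = - (x^2 - 1) phi], the difference of the two integrands, weighted by [phi], is
    the exact derivative of [x phi h], which vanishes at both ends. *)
Lemma gauss_ibp h dh (C theta : R) : theta < 1 / 2 ->
  (forall x : R, is_derive x (1 : R) h (dh x)) -> continuous dh ->
  (forall x, `|h x| <= C * expR (theta * x ^+ 2)) ->
  gamma.-integrable setT (EFin \o (fun x => (x ^+ 2 - 1) * h x)) ->
  gamma.-integrable setT (EFin \o (fun x => x * dh x)) ->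
  (\int[gamma]_x ((x ^+ 2 - 1) * h x)%:E = \int[gamma]_x (x * dh x)%:E)%E.
Proof.
move=> ht dhh cdh hb i1 i2.
have ch := is_derive_continuous dhh.
have csq : continuous (fun x : R => x ^+ 2 - 1).
  by move=> x; apply: cvgB; [exact: exprn_continuous|exact: cvg_cst].
have c1 : continuous (fun x : R => (x ^+ 2 - 1) * h x).
  by move=> x; apply: cvgM; [exact: csq|exact: ch].
have c2 : continuous (fun x : R => x * dh x).
  by move=> x; apply: cvgM; [exact: cvg_id|exact: cdh].
have c12 : continuous (fun x : R => x * dh x - (x ^+ 2 - 1) * h x).
  by move=> x; apply: cvgB; [exact: c2|exact: c1].
have m1 := continuous_measurable c1; have m2 := continuous_measurable c2.
have i12 : gamma.-integrable setT (EFin \o (fun x => x * dh x - (x ^+ 2 - 1) * h x)).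
  have := integrableB measurableT i2 i1.
  by apply: eq_integrable.
have dK (x : R) : is_derive x (1 : R) (fun x => x * phi x * h x)
   ((x * dh x - (x ^+ 2 - 1) * h x) * phi x).
  apply: (@is_derive_eq _ _ _ _ _ _ _ _ (is_derive_mul
    (is_derive_mul (is_derive_id x (1 : R)) (is_derive_gauss_pdf x)) (dhh x))).
  by rewrite /=; ring.
have [D hD] := gauss_tail ht hb.
have Kto0 : forall e : R, 0 < e -> exists A, forall x, A < `|x| -> `|x * phi x * h x| <= e.
  move=> e e0; exists (Num.max 0 (D / e)) => x; rewrite gt_max => /andP[x0 hx].
  apply: (le_trans (hD x x0)); rewrite ler_pdivrMr // mulrC -ler_pdivrMr //; exact: ltW.
have := FTC_line dK.
rewrite -(integral_gauss (continuous_measurable c12) i12) => h0.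
have : (\int[gamma]_x (x * dh x - (x ^+ 2 - 1) * h x)%:E = 0)%E.
  apply: h0.
  - by move=> x; apply: cvgM; [exact: c12|exact: continuous_gauss_pdf].
  - exact: integrable_gauss (continuous_measurable c12) i12.
  - apply/cvgrPdist_le => e e0; have [A hA] := Kto0 e e0.
    near=> x; rewrite sub0r normrN; apply: hA.
    apply: lt_le_trans (ler_norm _); near: x; by apply: nbhs_pinfty_gt; exact: num_real.
  - apply/cvgrPdist_le => e e0; have [A hA] := Kto0 e e0.
    near=> x; rewrite sub0r normrN; apply: hA.
    rewrite -normrN; apply: lt_le_trans (ler_norm _); rewrite ltrNr.
    near: x; by apply: nbhs_ninfty_lt; exact: num_real.
rewrite integralB_EFin // => /eqP; rewrite sube_eq ?integrable_fin_num //.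
by rewrite add0e => /eqP ->.
Unshelve. all: by end_near. Qed.

End gaussian_ibp.

(** * Growth of functions with a square-integrable derivative *)

Section growth.
Context (R : realType).
Notation mu := (@lebesgue_measure R).
Notation gamma := (normal_prob (0 : R) 1).
Notation phi := (normal_pdf (0 : R) 1).
Implicit Types g dg : R -> R.

(** The increment of [g] along the parabola [y] is the integral of [k]; a weighted AM-GM inequality
    bounds [|k|] by the square whose Gaussian integral is finite plus an explicit remainder. *)
Lemma gauss_growth g dg (a rho theta : R) : 1 / 4 < theta ->
  (forall x : R, is_derive x (1 : R) g (dg x)) -> continuous dg ->
  (\int[gamma]_x (dg (a * (x ^+ 2 - 1) + rho) ^+ 2)%:E < +oo)%E ->
  exists C, 0 <= C /\
    forall n, 0 <= n -> `|g (a * (n ^+ 2 - 1) + rho)| <= C * expR (theta * n ^+ 2).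
Proof.
move=> ht dgg cdg Jfin.
pose y (x : R) := a * (x ^+ 2 - 1) + rho.
have dy (x : R) : is_derive x (1 : R) y (2 * a * x).
  have -> : y = (fun x => a * x ^+ 2 + (rho - a)).
    by apply/funext => z; rewrite /y; ring.
  apply: (@is_derive_eq _ _ _ _ _ _ _ _ (is_derive_add
    (is_derive_scale a (is_derive_square x)) (is_derive_cst (rho - a) x 1))).
  by rewrite addr0; ring.
have cy : continuous y := is_derive_continuous dy.
pose k x := dg (y x) * (2 * a * x).
have dk (x : R) : is_derive x (1 : R) (g \o y) (k x).
  exact: is_derive1_comp.
have cdgy : continuous (fun x => dg (y x)).
  by move=> x; apply: continuous_comp; [exact: cy|exact: cdg].
have ck : continuous k.
  move=> x; apply: cvgM; first exact: cdgy.
  by apply: cvgM; [exact: cvg_cst|exact: cvg_id].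
pose w x := dg (y x) ^+ 2 * phi x.
have cw : continuous w.
  by apply: continuous_mul; [exact: continuous_square|exact: continuous_gauss_pdf].
have w0 x : 0 <= w x by rewrite mulr_ge0 ?sqr_ge0 ?normal_pdf_ge0.
have mdgy : measurable_fun setT (fun x => dg (y x) ^+ 2).
  by apply: continuous_measurable; exact: continuous_square.
move: Jfin; rewrite ge0_integral_gauss //; last by move=> x; exact: sqr_ge0.
rewrite -/(w _) => Jfin.
pose J := fine (\int[mu]_x (w x)%:E).
have J0 : 0 <= J by apply/fine_ge0/integral_ge0 => x _; rewrite lee_fin.
pose c := @normal_peak R 1.
have c0 : 0 < c by rewrite /c normal_peak_gt0 // oner_neq0.
have int_itv (f : R -> R) n : continuous f -> mu.-integrable `[0, n] (EFin \o f).
  move=> cf; apply: continuous_compact_integrable; first exact: segment_compact.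
  exact: continuous_subspaceT.
have bound n : 0 <= n -> `|g (y n) - g (y 0)| <=
    (J + a ^+ 2 / c * n ^+ 3) * expR (n ^+ 2 / 4).
  move=> n0.
  (* This weight balances the two terms. The first integrates to at most [lam * J]; on [0, n] the
     density is at least [c exp(- n^2/2) = c / lam^2], so the second, [(a x)^2 / (lam phi(x))], is
     at most [e]. *)
  pose lam := expR (n ^+ 2 / 4); pose e := a ^+ 2 / c * n ^+ 2 * lam.
  have lam0 : 0 < lam by exact: expR_gt0.
  have -> : g (y n) - g (y 0) = \int[mu]_(x in `[0, n]) k x.
    by rewrite /Rintegral (FTC_itv dk ck n0).
  apply: (le_trans (le_normr_Rintegral _ (int_itv _ _ ck))) => //.
  have cabs : continuous (fun x => `|k x|).
    by move=> x; apply: continuous_comp (ck x) _; exact: norm_continuous.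
  have clw : continuous (fun x => lam * w x).
    by move=> x; apply: cvgM; [exact: cvg_cst|exact: cw].
  have ccst : continuous (fun _ : R => e) by move=> x; exact: cvg_cst.
  have clwe : continuous (fun x => lam * w x + e).
    by move=> x; apply: cvgD; [exact: clw|exact: ccst].
  apply: (@le_trans _ _ (\int[mu]_(x in `[0, n]) (lam * w x + e))).
    apply: le_Rintegral => //; [exact: int_itv|exact: int_itv|].
    move=> x; rewrite /= in_itv /= => /andP[x0 xn].
    rewrite /w gauss_pdfE -/c /k !normrM.
    set d := dg (y x); set E := expR (- (x ^+ 2 / 2)).
    have E0 : 0 < E by exact: expR_gt0.
    have hE : expR (- (n ^+ 2 / 2)) <= E.
      rewrite ler_expR; have : x ^+ 2 <= n ^+ 2 by rewrite lerXn2r // nnegrE.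
      by lra.
    have lamE : 1 <= lam * lam * E.
      rewrite -expRD; apply: le_trans (ler_wpM2l _ hE); last exact: expR_ge0.
      by rewrite -expRD (_ : _ + _ = 0) ?expR0 //; field.
    have hx : a ^+ 2 * x ^+ 2 / (lam * (c * E)) <= e.
      rewrite ler_pdivrMr ?mulr_gt0 //.
      have -> : e * (lam * (c * E)) = a ^+ 2 * n ^+ 2 * (lam * lam * E).
        by rewrite /e; field; rewrite gt_eqF.
      apply: (@le_trans _ _ (a ^+ 2 * n ^+ 2)).
        by rewrite ler_wpM2l ?sqr_ge0 // lerXn2r // nnegrE.
      by rewrite ler_peMr // mulr_ge0 // sqr_ge0.
    apply: le_trans (lerD (lexx _) hx).
    (* AM-GM: [2 |d| |a x| <= lam c E d^2 + (a x)^2 / (lam c E)] *)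
    pose u := lam * (c * E); have u0 : 0 < u by rewrite !mulr_gt0.
    have -> : lam * (d ^+ 2 * (c * E)) = u * `|d| ^+ 2.
      by rewrite real_normK ?num_real // /u; ring.
    rewrite -/u (ger0_norm (ler0n R 2)) -[a ^+ 2](real_normK
      (num_real a)) -[x ^+ 2](real_normK (num_real x)).
    have -> : u * `|d| ^+ 2 + `|a| ^+ 2 * `|x| ^+ 2 / u
       = `|d| * (2 * `|a| * `|x|) + (u * `|d| - `|a| * `|x|) ^+ 2 / u.
      by field; rewrite gt_eqF.
    by rewrite lerDl divr_ge0 ?sqr_ge0 // ltW.
  rewrite RintegralD // ?Rintegral_cst ?RintegralZl //; try exact: int_itv.
  have -> : fine (mu `[0, n]) = n.
    rewrite lebesgue_measure_itv /= lte_fin.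
    by move: n0; rewrite le_eqVlt => /orP[/eqP<-|->] /=; rewrite ?ltxx ?subr0.
  have hJ : \int[mu]_(x in `[0, n]) w x <= J.
    apply: fine_le.
    - by apply: integrable_fin_num => //; exact: int_itv.
    - by rewrite ge0_fin_numE //; apply: integral_ge0 => x _; rewrite lee_fin.
    - apply: ge0_subset_integral => //.
        by apply/measurable_EFinP; exact: continuous_measurable.
      by move=> x _; rewrite lee_fin.
  have -> : (J + a ^+ 2 / c * n ^+ 3) * expR (n ^+ 2 / 4) = lam * J + e * n.
    by rewrite /e /lam; ring.
  by rewrite lerD2r ler_pM2l.
(* The surplus of [theta] over 1/4 absorbs the cubic factor of [bound], through [n^3 <= 1 + n^4] and
   [expR_quad_ub]. *)
pose d := theta - 1 / 4; have d0 : 0 < d by rewrite /d; lra.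
have h2 : 0 <= a ^+ 2 / c by rewrite divr_ge0 ?sqr_ge0 // ltW.
have h3 : 0 <= 1 + 4 / d ^+ 2 by rewrite addr_ge0 // divr_ge0 ?sqr_ge0.
exists (`|g (y 0)| + J + a ^+ 2 / c * (1 + 4 / d ^+ 2)); split.
  by rewrite !addr_ge0 // mulr_ge0.
move=> n n0; rewrite -/(y n).
set E := expR _.
have E1 : 1 <= E by rewrite -expR0 ler_expR mulr_ge0 ?sqr_ge0 //; lra.
have EE : E = expR (d * n ^+ 2) * expR (n ^+ 2 / 4).
  by rewrite -expRD /E; congr expR; rewrite /d; field.
have F1 : 1 <= expR (d * n ^+ 2) by rewrite -expR0 ler_expR mulr_ge0 ?sqr_ge0 // ltW.
have n3 : n ^+ 3 <= (1 + 4 / d ^+ 2) * expR (d * n ^+ 2).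
  have h := expR_quad_ub n d0.
  have : n ^+ 4 <= 4 / d ^+ 2 * expR (d * n ^+ 2).
    rewrite mulrAC ler_pdivlMr ?exprn_gt0 //; lra.
  have : n ^+ 3 <= 1 + n ^+ 4.
    have [n1|n1] := leP n 1.
      by rewrite (le_trans (exprn_ile1 _ _ _)) // lerDl exprn_ge0.
    rewrite (@le_trans _ _ (n ^+ 4)) ?lerDr //.
    by rewrite [leRHS]exprS ler_peMl ?exprn_ge0 // ltW.
  by rewrite mulrDl mul1r; lra.
have -> : g (y n) = g (y 0) + (g (y n) - g (y 0)) by rewrite addrC subrK.
apply: (le_trans (ler_normD _ _)).
rewrite -addrA mulrDl lerD // ?ler_peMr //.
apply: (le_trans (bound n n0)); rewrite EE [leRHS]mulrA ler_pM2r ?expR_gt0 //.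
by rewrite mulrDl lerD ?ler_peMr // -[leRHS]mulrA ler_wpM2l.
Qed.

End growth.

(** * Growth along the quadratic form of the target *)

Section growth_class.
Context (R : realType).
Notation gamma := (normal_prob (0 : R) 1).
Implicit Types g dg : R -> R.

(** Each [x >= rho - a] is the value of the parabola at the square root of [m = (x - rho) / a + 1],
    and [x <= a S + K] bounds [m] by [S] plus a constant that is moved into the prefactor. *)
Lemma upper_growth g dg (a rho theta K : R) : 0 < a -> 1 / 4 < theta ->
  (forall x : R, is_derive x (1 : R) g (dg x)) -> continuous dg ->
  (\int[gamma]_x (dg (a * (x ^+ 2 - 1) + rho) ^+ 2)%:E < +oo)%E ->
  exists B C, 0 <= C /\
    forall x S, B <= x -> x <= a * S + K -> `|g x| <= C * expR (theta * S).
Proof.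
move=> a0 ht dgg cdg Jfin.
have [C [C0 hC]] := gauss_growth ht dgg cdg Jfin.
exists (rho - a), (C * expR (theta * ((K - rho) / a + 1))).
split=> [|x S hB hS]; first by rewrite mulr_ge0 ?expR_ge0.
pose m := (x - rho) / a + 1.
have m0 : 0 <= m.
  rewrite /m -[1](@divff _ a) ?gt_eqF // -mulrDl divr_ge0 //; [lra|exact: ltW].
have := hC _ (sqrtr_ge0 m); rewrite sqr_sqrtr //.
have -> : a * (m - 1) + rho = x by rewrite /m; field; rewrite gt_eqF.
move=> h; apply: (le_trans h); rewrite -mulrA -expRD ler_wpM2l // ler_expR.
rewrite -mulrDr ler_pM2l; last by lra.
have -> : (K - rho) / a + 1 + S = (a * S + K - rho) / a + 1 by field; rewrite gt_eqF.
by rewrite lerD2r ler_pM2r ?invr_gt0 //; lra.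
Qed.

Variables (q : nat) (alpha : 'I_q -> R).

(* A square-integrable derivative yields any rate above 1/4 ([gauss_growth]),
   and rates below 1/2 are integrable, so there is room to absorb polynomial
   factors. The shift [rho] makes the bound usable with one coordinate free and
   the others frozen at arbitrary values. *)
Definition gaussian_growth g := forall theta K : R, 1 / 4 < theta ->
  exists C, 0 <= C /\ forall (x : 'I_q -> R) (rho : R), `|rho| <= K ->
    `|g (\sum_j alpha j * x j ^+ 2 + rho)| <= C * expR (theta * \sum_j x j ^+ 2).

Lemma sumsq_ge0 (x : 'I_q -> R) : 0 <= \sum_j x j ^+ 2.
Proof. by apply: sumr_ge0 => j _; exact: sqr_ge0. Qed.

(** Large positive values, large negative values and the compact middle range are bounded
    separately. *)
Lemma growth_of_L2 g dg :
  (forall x : R, is_derive x (1 : R) g (dg x)) -> continuous dg ->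
  (forall i, alpha i != 0 -> exists rho,
    (\int[gamma]_x (dg (alpha i * (x ^+ 2 - 1) + rho) ^+ 2)%:E < +oo)%E) ->
  gaussian_growth g.
Proof.
move=> dgg cdg hL2 theta K ht.
have cg := is_derive_continuous dgg.
(* The sign [eps] treats both tails at once: [eps = 1] the values above a threshold, [eps = -1]
   those below one. *)
have key : forall (eps : R), eps ^+ 2 = 1 -> exists B C, 0 <= C /\
  forall (x : 'I_q -> R) (rho : R), `|rho| <= K ->
    B <= eps * (\sum_j alpha j * x j ^+ 2 + rho) ->
    `|g (\sum_j alpha j * x j ^+ 2 + rho)| <= C * expR (theta * \sum_j x j ^+ 2).
  move=> eps eps2.
  have epsK z : eps * (eps * z) = z by rewrite mulrA -expr2 eps2 mul1r.
  have neps : `|eps| = 1 by apply/eqP; rewrite -sqrp_eq1 // -normrX eps2 normr1.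
  have sum_ub (a : R) (x : 'I_q -> R) rho : (forall j, eps * alpha j <= a) -> `|rho| <= K ->
     eps * (\sum_j alpha j * x j ^+ 2 + rho) <= a * (\sum_j x j ^+ 2) + K.
    move=> ha hr; rewrite mulrDr lerD //.
      by rewrite !mulr_sumr ler_sum // => j _; rewrite mulrA ler_wpM2r ?sqr_ge0.
    by apply: le_trans (ler_norm _) _; rewrite normrM neps mul1r.
  (* If the largest [eps * alpha i] is positive, it dominates the form on this side, and square
     integrability along that single coordinate is enough. *)
  have [i hi|none] := pickP (fun i => (0 < eps * alpha i) && [forall j,
    eps * alpha j <= eps * alpha i]).
    have /andP[ai /forallP imax] := hi.
    have [rho hrho] : exists rho,
      (\int[gamma]_x (dg (alpha i * (x ^+ 2 - 1) + rho) ^+ 2)%:E < +oo)%E.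
      by apply: hL2; apply: contraTneq ai => ->; rewrite mulr0 ltxx.
    have dgg' (x : R) : is_derive x (1 : R) (fun z => g (eps * z)) (eps * dg (eps * x)).
      apply: (@is_derive_eq _ _ _ _ _ _ _ _ (is_derive1_comp (dgg (eps * x))
        (is_derive_scale eps (is_derive_id x (1 : R))))).
      by rewrite mulr1 mulrC.
    have cdg' : continuous (fun x => eps * dg (eps * x)).
      apply: continuous_mul; first exact: continuous_const.
      move=> x; apply: continuous_comp; last exact: cdg.
      by apply: continuous_mul; [exact: continuous_const|move=> ?; exact: cvg_id].
    have [] := @upper_growth _ _ (eps * alpha i) (eps * rho) theta K ai ht dgg' cdg'.
      apply: le_lt_trans hrho; rewrite le_eqVlt; apply/orP; left; apply/eqP.
      apply: eq_integral => x _; rewrite exprMn eps2 mul1r; congr (dg _ ^+ 2)%:E.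
      by rewrite -mulrA -mulrDr epsK.
    move=> B [C [C0 hC]]; exists B, C; split => // x rho' hr hB.
    have := hC _ (\sum_j x j ^+ 2) hB; rewrite epsK; apply.
    exact: sum_ub.
  have nonpos : forall j, eps * alpha j <= 0.
    case: q alpha none => [|n] al none' j; first by case: j.
    rewrite leNgt; apply/negP => hj.
    have := none' [arg max_(i > j) (eps * al i)]%O; case: arg_maxP => //= k _ kmax.
    move/negbT; rewrite negb_and -leNgt => /orP[k0|/negP []].
      by have := lt_le_trans hj (le_trans (kmax j isT) k0); rewrite ltxx.
    by apply/forallP => l; exact: kmax.
  (* With no coefficient of this sign, [eps] times the argument stays below [K], so the threshold
     [K + 1] is never reached. *)
  exists (K + 1), 0; split => // x rho hr hB.
  have := sum_ub 0 x rho nonpos hr; rewrite mul0r add0r => h.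
  by exfalso; lra.
have [B1 [C1 [C10 h1]]] := key 1 (expr1n _ _).
have [B2 [C2 [C20 h2]]] := key (- 1) (etrans (sqrrN 1) (expr1n _ _)).
have [C3 [C30 h3]] := continuous_bounded_itv (- B2) B1 cg.
exists (C1 + C2 + C3); split; first by rewrite !addr_ge0.
move=> x rho hr; set y := _ + rho; set E := expR _.
have E1 : 1 <= E by rewrite -expR0 ler_expR mulr_ge0 ?sumsq_ge0 //; lra.
have E0 : 0 <= E by lra.
have [hB1|hB1] := leP B1 (1 * y).
  have := h1 x rho hr hB1; rewrite -/y -/E; nra.
have [hB2|hB2] := leP B2 (- 1 * y).
  have := h2 x rho hr hB2; rewrite -/y -/E; nra.
have := h3 y _; rewrite mul1r in hB1; rewrite mulN1r in hB2.
move=> h; have {}h : `|g y| <= C3 by apply: h; apply/andP; split; lra.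
have : C3 <= C3 * E by rewrite ler_peMr.
have : 0 <= C1 * E by rewrite mulr_ge0.
have : 0 <= C2 * E by rewrite mulr_ge0.
by rewrite !mulrDl; lra.
Qed.

(** The mean value theorem costs a factor [|y| <= A S]. A rate [th'] strictly between 1/4 and
    [theta] is used for the derivative, and [S <= exp(d S) / d] with [d = theta - th'] absorbs that
    factor. *)
Lemma growth_antiderivative g dg :
  (forall x : R, is_derive x (1 : R) g (dg x)) -> gaussian_growth dg -> gaussian_growth g.
Proof.
move=> dgg hdg theta K ht.
have cg := is_derive_continuous dgg.
pose th' := (theta + 1 / 4) / 2; have ht' : 1 / 4 < th' by rewrite /th'; lra.
pose d := theta - th'; have d0 : 0 < d by rewrite /d /th'; lra.
have [C [C0 hC]] := hdg th' K ht'.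
have [C1 [C10 h1]] := continuous_bounded_itv (- K) K cg.
pose A := \sum_j `|alpha j|; have A0 : 0 <= A by apply: sumr_ge0.
exists (C1 + A * C / d); split; first by rewrite addr_ge0 // !mulr_ge0 ?invr_ge0 // ltW.
move=> x rho hr; set S := \sum_j x j ^+ 2; set y := \sum_j alpha j * _.
have S0 : 0 <= S by exact: sumsq_ge0.
have dpath (t : R) : is_derive t (1 : R) (fun t => g (y * t + rho)) (dg (y * t + rho) * y).
  exact: (is_derive1_comp (dgg _) (is_derive_affine y rho t)).
have cpath : {within `[0, 1], continuous (fun t => g (y * t + rho))}.
  by apply: continuous_subspaceT; exact: is_derive_continuous dpath.
have [t] := MVT ltr01 (fun t _ => dpath t) cpath.
rewrite in_itv /= => /andP[t0 t1]; rewrite mulr1 mulr0 add0r subr0 mulr1 => hmv.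
(* The intermediate point is again a value of the quadratic form, at the vector scaled by the square
   root of [t], whose sum of squares is at most [S]. *)
have ys : y * t = \sum_j alpha j * (Num.sqrt t * x j) ^+ 2.
  rewrite /y mulr_suml; apply: eq_bigr => j _.
  rewrite exprMn sqr_sqrtr 1?ltW //. by rewrite -mulrA [in RHS](mulrC t). 
have hdgt : `|dg (y * t + rho)| <= C * expR (th' * S).
  rewrite ys; apply: (le_trans (hC _ _ hr)); rewrite ler_wpM2l // ler_expR.
  rewrite ler_wpM2l //; first by lra.
  rewrite /S ler_sum // => j _; rewrite exprMn sqr_sqrtr ?(ltW t0) //.
  by rewrite ler_piMl ?sqr_ge0 // ltW.
have hy : `|y| <= A * S.
  apply: (le_trans (ler_norm_sum _ _ _)); rewrite /A mulr_suml ler_sum // => j _.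
  rewrite normrM ler_wpM2l // ger0_norm ?sqr_ge0 // /S (bigD1 j) //= lerDl.
  by apply: sumr_ge0 => k _; exact: sqr_ge0.
have hrho : `|g rho| <= C1 by apply: h1; rewrite -ler_norml.
have hS : S <= expR (d * S) / d.
  rewrite ler_pdivlMr //; have := expR_ge1Dx (d * S); lra.
have -> : g (y + rho) = g rho + (g (y + rho) - g rho) by rewrite [RHS]addrC subrK.
rewrite hmv; apply: (le_trans (ler_normD _ _)).
have E1 : 1 <= expR (theta * S) by rewrite -expR0 ler_expR mulr_ge0 //; lra.
rewrite mulrDl lerD //; first by apply: (le_trans hrho); rewrite ler_peMr.
rewrite normrM mulrC.
have EE : expR (theta * S) = expR (d * S) * expR (th' * S).
  by rewrite -expRD; congr expR; rewrite /d; ring.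
apply: (@le_trans _ _ (A * S * (C * expR (th' * S)))).
  by apply: ler_pM.
rewrite EE; have -> : A * C / d * (expR (d * S) * expR (th' * S)) =
  A * (expR (d * S) / d) * (C * expR (th' * S)) by ring.
rewrite ler_wpM2r ?mulr_ge0 ?expR_ge0 // ler_wpM2l //.
Qed.

End growth_class.

(** * The Stein identity of the target *)

Section target.
Context (R : realType) (q : nat) (alpha : 'I_q -> R)
  (d : measure_display) (T : measurableType d) (P : probability T R)
  (N : 'I_q -> {RV P >-> R}).
Hypothesis hN : iid_std_normal N.
Notation gamma := (normal_prob (0 : R) 1).
Notation F := (quad_target alpha N).

Definition sumsq (w : T) : R := \sum_j N j w ^+ 2.
Definition rest (i : 'I_q) (w : T) : R := \sum_(j < q | j != i) alpha j * (N j w ^+ 2 - 1).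

Lemma measurable_N i : measurable_fun setT (N i).
Proof. exact: measurable_funP. Qed.

(* The library equips [R] with two distinct (convertible up to their displays)
   measurable structures; [normal_prob] lives on [measurableTypeR R], random
   variables take values in the other one, and [idR] transports between them. *)
Definition idR : measurableTypeR R -> R := idfun.

#[local] HB.instance Definition _ :=
  @isMeasurableFun.Build _ _ _ _ idR (@measurable_id _ _ setT).

Lemma coord_distribution i (A : set R) : measurable A ->
  distribution P (N i) A = distribution gamma idR A.
Proof. exact: hN.2. Qed.

Lemma ge0_integral_coord i (f : R -> \bar R) :
  measurable_fun setT f -> (forall x, 0 <= f x)%E ->
  (\int[distribution P (N i)]_x f x = \int[gamma]_x f x)%E.
Proof.
move=> mf f0.
rewrite (eq_measure_integral (distribution gamma idR)); last first.
  by move=> A mA _; exact: coord_distribution.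
exact: (ge0_integral_distribution (idR : {mfun measurableTypeR R >-> R})).
Qed.

Lemma integrable_coord i (f : R -> \bar R) :
  (distribution P (N i)).-integrable setT f -> gamma.-integrable setT f.
Proof.
move=> /integrableP[mf h]; apply/integrableP; split => //.
by rewrite -(ge0_integral_coord i) //; exact: measurableT_comp.
Qed.

Lemma integral_coord i (f : R -> \bar R) : (distribution P (N i)).-integrable setT f ->
  (\int[distribution P (N i)]_x f x = \int[gamma]_x f x)%E.
Proof.
move=> intf; rewrite (eq_measure_integral (distribution gamma idR)); last first.
  by move=> A mA _; exact: coord_distribution.
apply: (integral_distribution (X := (idR : {mfun measurableTypeR R >-> R}))).
  by have /integrableP[] := intf.
exact: integrable_coord intf.
Qed.

Lemma measurable_rest i : measurable_fun setT (rest i).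
Proof.
rewrite /rest; under eq_fun do rewrite big_mkcond.
apply: measurable_sum => j; case: (j != i) => //.
apply: measurable_funM => //; apply: measurable_funB => //.
by apply: measurable_funX; exact: measurable_N.
Qed.

HB.instance Definition _ i :=
  isMeasurableFun.Build _ _ _ _ (rest i) (measurable_rest i).

Lemma indep_rest i (A B : set R) : measurable A -> measurable B ->
  P (N i @^-1` A `&` rest i @^-1` B) = (P (N i @^-1` A) * P (rest i @^-1` B))%E.
Proof.
apply: (@indep_coord _ _ _ _ _ _ hN.1 i (~: [set i])); first by rewrite !inE eqxx.
rewrite /rest; under eq_fun do rewrite big_mkcond.
apply: measurable_sum => j; case: eqVneq => [//|ji] /=.
apply: measurable_funM => //; apply: measurable_funB => //.
by apply: measurable_funX; apply: cylinders_coord; rewrite !inE.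
Qed.

Lemma targetE i w : F w = alpha i * (N i w ^+ 2 - 1) + rest i w.
Proof. by rewrite /quad_target (bigD1 i). Qed.

Lemma target_sumsq w : F w = \sum_j alpha j * N j w ^+ 2 + - \sum_j alpha j.
Proof.
by rewrite -sumrB; apply: eq_bigr => j _; rewrite mulrBr mulr1.
Qed.

Lemma measurable_target : measurable_fun setT F.
Proof. exact: measurable_quad_target. Qed.

Lemma measurable_sumsq : measurable_fun setT sumsq.
Proof. by apply: measurable_sum => j; apply: measurable_funX; exact: measurable_N. Qed.

(** Independence reduces this to one coordinate. Separate rates [c j] cover both the uniform rate
    [theta] and the rates [t alpha_j] of the moment generating function of the target. *)
Lemma sumsq_mgf (c : 'I_q -> R) : (forall j, c j < 1 / 2) ->
  (\int[P]_w (expR (\sum_j c j * N j w ^+ 2))%:E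
   = (\prod_j (Num.sqrt (1 - 2 * c j))^-1)%:E)%E.
Proof.
move=> hc; under eq_integral do rewrite expR_sum.
rewrite (expectation_prod_indep hN.1 (g := fun j x => expR (c j * x ^+ 2))).
- rewrite -prodEFin; apply: eq_bigr => j _.
  rewrite -(gauss_square_mgf (hc j)) ge0_integral_coord //.
    apply/measurable_EFinP; apply: measurableT_comp => //.
    by apply: measurable_funM => //; exact: measurable_funX.
- move=> j; apply: measurableT_comp => //.
  by apply: measurable_funM => //; exact: measurable_funX.
- by move=> j x; exact: expR_ge0.
Qed.

Lemma integrable_expR_sumsq (theta : R) : theta < 1 / 2 ->
  P.-integrable setT (EFin \o (fun w => expR (theta * sumsq w))).
Proof.
move=> ht; apply/integrableP; split.
  apply/measurable_EFinP; apply: measurableT_comp => //.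
  by apply: measurable_funM => //; exact: measurable_sumsq.
under eq_integral do rewrite /= ger0_norm ?expR_ge0 // /sumsq mulr_sumr.
by rewrite (sumsq_mgf (fun=> ht)) ltry.
Qed.

Lemma integrable_dominated (f : T -> R) (C theta : R) : theta < 1 / 2 ->
  measurable_fun setT f -> (forall w, `|f w| <= C * expR (theta * sumsq w)) ->
  P.-integrable setT (EFin \o f).
Proof.
move=> ht mf hf.
apply: (@le_integrable _ _ _ _ _ _ _ (fun w => C%:E * (EFin \o (fun w => expR
  (theta * sumsq w))) w)%E) => //.
- exact/measurable_EFinP.
- move=> w _ /=; rewrite lee_fin; apply: le_trans (hf w) _; exact: ler_norm.
- by apply: integrableZl => //; exact: integrable_expR_sumsq.
Qed.

Lemma sumsq_coord i w : 0 <= N i w ^+ 2 <= sumsq w.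
Proof.
rewrite sqr_ge0 /sumsq (bigD1 i) //= lerDl.
by apply: sumr_ge0 => j _; exact: sqr_ge0.
Qed.

(** Rate 3/8 for [g] and 1/16 for the polynomial factor add up to 7/16, still below 1/2. *)
Lemma integrable_growth (g : R -> R) i m : (m <= 2)%N ->
  continuous g -> gaussian_growth alpha g ->
  P.-integrable setT (EFin \o (fun w => (N i w ^+ 2) ^+ m * g (F w))).
Proof.
move=> hm cg hg.
have h38 : (1 : R) / 4 < 3 / 8 by lra.
have [C [C0 hC]] := hg (3 / 8) `|- \sum_j alpha j| h38.
(* This is [32^2], from squaring [1 + S <= 32 exp(S / 32)]. *)
pose D : R := 16 ^+ 2 * 4.
apply: (@integrable_dominated _ (C * D) (7 / 16)); first by lra.
  apply: measurable_funM.
    by apply: measurable_funX; apply: measurable_funX; exact: measurable_N.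
  by apply: measurableT_comp; [exact: continuous_measurable|exact: measurable_target].
move=> w; rewrite normrM mulrC.
have /andP[n0 nS] := sumsq_coord i w.
have hg' := hC (fun j => N j w) _ (lexx _); rewrite -target_sumsq -/(sumsq w) in hg'.
have S0 : 0 <= sumsq w by exact: le_trans nS.
have e1 := expR_ge1Dx (1 / 32 * sumsq w).
have hS : `|(N i w ^+ 2) ^+ m| <= D * expR (1 / 16 * sumsq w).
  rewrite normrX (ger0_norm n0).
  have : (N i w ^+ 2) ^+ m <= (1 + sumsq w) ^+ m by rewrite lerXn2r // ?nnegrE; lra.
  move=> h; apply: (le_trans h).
  have : (1 + sumsq w) ^+ m <= (1 + sumsq w) ^+ 2 by rewrite ler_weXn2l //; lra.
  move=> h'; apply: (le_trans h').
  have -> : D * expR (1 / 16 * sumsq w) = (32 * expR (1 / 32 * sumsq w)) ^+ 2.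
    rewrite exprMn expr2 [in RHS]expr2 -expRD /D (_ : _ + _ = 1 / 16 * sumsq w);
      last by field.
    by congr (_ * _); ring.
  by rewrite lerXn2r // ?nnegrE //; lra.
apply: (le_trans (ler_pM _ _ hg' hS)) => //.
rewrite mulrACA ler_wpM2l ?mulr_ge0 // -expRD ler_expR; lra.
Qed.

End target.

(** * Integration by parts in one coordinate of the target *)

Section target_ibp.
Context (R : realType) (q : nat) (alpha : 'I_q -> R)
  (d : measure_display) (T : measurableType d) (P : probability T R)
  (N : 'I_q -> {RV P >-> R}).
Hypothesis hN : iid_std_normal N.
Notation gamma := (normal_prob (0 : R) 1).
Notation F := (quad_target alpha N).

Lemma measurable_shifted (g : R -> R) i : measurable_fun setT g ->
  measurable_fun setT (fun z : R * R => g (alpha i * (z.1 ^+ 2 - 1) + z.2)).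
Proof.
move=> mg; apply: measurableT_comp => //.
apply: measurable_funD => //; apply: measurable_funM => //.
by apply: measurable_funB => //; exact: measurable_funX.
Qed.

Lemma continuous_shifted (g : R -> R) (a v : R) : continuous g ->
  continuous (fun x : R => g (a * (x ^+ 2 - 1) + v)).
Proof.
move=> cg x; apply: continuous_comp; last exact: cg.
apply: continuous_add; last exact: continuous_const.
apply: continuous_mul; first exact: continuous_const.
apply: continuous_add; last exact: continuous_const.
by apply: continuous_square => ?; exact: cvg_id.
Qed.

(** By Tonelli the double integral is finite; if the inner integral were infinite for every value of
    [rest], integrating it against a probability would give infinity. *)
Lemma exists_rest (g : R -> R) i : continuous g ->
  (\int[P]_w (g (F w) ^+ 2)%:E < +oo)%E ->
  exists rho, (\int[gamma]_x (g (alpha i * (x ^+ 2 - 1) + rho) ^+ 2)%:E < +oo)%E.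
Proof.
move=> cg; pose f (z : R * R) := (g (alpha i * (z.1 ^+ 2 - 1) + z.2) ^+ 2)%:E.
have mg2 : measurable_fun setT (fun x => g x ^+ 2).
  by apply: continuous_measurable; exact: continuous_square.
have mf : measurable_fun setT f.
  by apply/measurable_EFinP; exact: (measurable_shifted (g := fun x => g x ^+ 2)).
have -> : (\int[P]_w (g (F w) ^+ 2)%:E = \int[P]_w f (N i w, rest alpha N i w))%E.
  by apply: eq_integral => w _; rewrite (targetE _ _ i).
rewrite (ge0_integral_joint (indep_rest alpha hN i)) //; last first.
  by move=> z; rewrite lee_fin sqr_ge0.
move=> hfin; apply: contrapT => /forallNP hoo; move: hfin.
have -> : (\int[distribution P (rest alpha N i)]_v \int[distribution P (N i)]_u f (u, v)
    = \int[distribution P (rest alpha N i)]_v +oo)%E.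
  apply: eq_integral => v _; rewrite ge0_integral_coord //; last 2 first.
  - apply/measurable_EFinP; apply: (@continuous_measurable _ (fun x : R => _ ^+ 2)).
    by apply: continuous_square; exact: continuous_shifted.
  - by move=> x; rewrite lee_fin sqr_ge0.
  by apply/eqP; have := hoo v; rewrite -leye_eq leNgt => /negP.
rewrite integral_cst // [X in (+oo * X)%E](_ : _ = 1%E); last exact: probability_setT.
by rewrite mule1.
Qed.

(** With [rest] frozen at [v], this is [gauss_ibp] for [h(x) = g(alpha_i (x^2 - 1) + v)], for which
    [x h'(x) = 2 alpha_i x^2 g']. *)
Lemma target_ibp (g dg : R -> R) i :
  (forall x : R, is_derive x (1 : R) g (dg x)) -> continuous dg ->
  gaussian_growth alpha g ->
  P.-integrable setT (EFin \o (fun w => (N i w ^+ 2 - 1) * g (F w))) ->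
  P.-integrable setT (EFin \o (fun w => N i w ^+ 2 * dg (F w))) ->
  \int[P]_w ((N i w ^+ 2 - 1) * g (F w))
  = 2 * alpha i * \int[P]_w (N i w ^+ 2 * dg (F w)).
Proof.
move=> dgg cdg gg i1 i2.
have cg := is_derive_continuous dgg.
pose f1 (z : R * R) := ((z.1 ^+ 2 - 1) * g (alpha i * (z.1 ^+ 2 - 1) + z.2))%:E.
pose f2 (z : R * R) := (z.1 * (2 * alpha i * z.1 * dg (alpha i * (z.1 ^+ 2 - 1) + z.2)))%:E.
have mf1 : measurable_fun setT f1.
  apply/measurable_EFinP; apply: measurable_funM.
    by apply: measurable_funB => //; exact: measurable_funX.
  by apply: measurable_shifted; exact: continuous_measurable.
have mf2 : measurable_fun setT f2.
  apply/measurable_EFinP; apply: measurable_funM => //; apply: measurable_funM.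
    exact: measurable_funM.
  by apply: measurable_shifted; exact: continuous_measurable.
have e1 w : ((N i w ^+ 2 - 1) * g (F w))%:E = f1 (N i w, rest alpha N i w).
  by rewrite /f1 /= -(targetE _ _ i).
have e2 w : (2 * alpha i * (N i w ^+ 2 * dg (F w)))%:E = f2 (N i w, rest alpha N i w).
  by rewrite /f2 /= -(targetE _ _ i); congr EFin; ring.
have j1 : P.-integrable setT (fun w => f1 (N i w, rest alpha N i w)).
  by apply: eq_integrable i1 => // w _; rewrite -e1.
have j2 : P.-integrable setT (fun w => f2 (N i w, rest alpha N i w)).
  apply: eq_integrable (integrableZl measurableT (2 * alpha i) i2) => // w _.
  by rewrite -e2 EFinM.
rewrite -RintegralZl // /Rintegral; congr fine.
under eq_integral do rewrite e1; under [RHS]eq_integral do rewrite e2.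
have indep := indep_rest alpha hN i.
rewrite (integral_joint indep mf1 j1) (integral_joint indep mf2 j2).
have k1 := integrable_joint indep mf1 j1; have k2 := integrable_joint indep mf2 j2.
apply: ae_eq_integral => //.
- exact: measurable_fubini_G k1.
- exact: measurable_fubini_G k2.
(* Sections are integrable for almost every [v] only, which suffices to equate the outer
   integrals. *)
have := ae_integrable2 k1; have := ae_integrable2 k2.
apply: filterS2 => v l2 l1 _.
have h38 : (1 : R) / 4 < 3 / 8 by lra.
have [C [C0 hC]] := gg (3 / 8) `|v - alpha i| h38.
rewrite (integral_coord hN l1) (integral_coord hN l2).
pose h x := g (alpha i * (x ^+ 2 - 1) + v).
pose dh x := 2 * alpha i * x * dg (alpha i * (x ^+ 2 - 1) + v).
have dhh (x : R) : is_derive x (1 : R) h (dh x).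
  have -> : h = g \o (fun x => alpha i * x ^+ 2 + (v - alpha i)).
    by apply/funext => z; rewrite /h /=; congr g; ring.
  apply: (@is_derive_eq _ _ _ _ _ _ _ _ (is_derive1_comp (dgg _) (is_derive_add
    (is_derive_scale (alpha i) (is_derive_square x)) (is_derive_cst (v - alpha i) x 1)))).
  rewrite addr0 /dh mulrC (_ : alpha i * (x ^+ 2 - 1) + v = alpha i * x ^+ 2 +
    (v - alpha i)); ring.
have cdh : continuous dh.
  apply: continuous_mul.
    by apply: continuous_mul; [exact: continuous_const|move=> ?; exact: cvg_id].
  exact: continuous_shifted.
apply: (gauss_ibp (h := h) (dh := dh) (theta := 3 / 8) (C := C)) => //.
- by lra.
(* The growth bound at the vector whose only nonzero coordinate is the [i]-th, with shift
   [v - alpha i], is the one-dimensional bound for [h]. *)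
- move=> x; have := hC (fun j => if j == i then x else 0) _ (lexx _).
  rewrite (bigD1 i) //= eqxx big1 => [|j /negbTE ->]; last by rewrite expr0n mulr0.
  rewrite (bigD1 i) //= eqxx big1 => [|j /negbTE ->]; last by rewrite expr0n.
  rewrite !addr0; congr (`|g _| <= _); ring.
- exact: integrable_coord l1.
- exact: integrable_coord l2.
Qed.

End target_ibp.

(** * Constant-coefficient operators on functions of class C^q *)

Section smooth.
Context (R : realType).
Implicit Types (f : R -> R) (p : {poly R}).

Lemma Ck_is_derive q f j (x : R) : Ck q f -> (j < q)%N ->
  is_derive x (1 : R) (derive1n j f) (derive1n j.+1 f x).
Proof.
move=> [df _] hj; apply: DeriveDef; first exact: df.
by rewrite derive1nS derive1E.
Qed.

Lemma Ck_continuous q f j : Ck q f -> (j <= q)%N -> continuous (derive1n j f).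
Proof.
move=> hf; rewrite leq_eqVlt => /orP[/eqP ->|hj]; first by case: hf.
by apply: is_derive_continuous => x; exact: Ck_is_derive hf hj.
Qed.

Lemma continuous_sum (I : Type) (r : seq I) (h : I -> R -> R) :
  (forall i, continuous (h i)) -> continuous (fun x => \sum_(i <- r) h i x).
Proof.
move=> hc; elim: r => [|i r IH].
  by under eq_fun do rewrite big_nil; exact: continuous_const.
by under eq_fun do rewrite big_cons; exact: continuous_add.
Qed.

Lemma dop_continuous q f p : Ck q f -> (size p <= q.+1)%N -> continuous (dop p f).
Proof.
move=> hf hp; rewrite /dop; apply: continuous_sum => k.
apply: continuous_mul; first exact: continuous_const.
by apply: Ck_continuous hf _; rewrite -ltnS (leq_trans _ hp).
Qed.

Lemma is_derive_sum_ord n (h dh : 'I_n -> R -> R) (x : R) :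
  (forall i, is_derive x (1 : R) (h i) (dh i x)) ->
  is_derive x (1 : R) (fun y => \sum_(i < n) h i y) (\sum_(i < n) dh i x).
Proof.
elim: n h dh => [|n IH] h dh hd.
  under eq_fun do rewrite big_ord0.
  by rewrite big_ord0; exact: is_derive_cst.
under eq_fun do rewrite big_ord_recl.
rewrite big_ord_recl; apply: (is_derive_add (hd ord0)).
by apply: (IH (fun i => h (lift ord0 i)) (fun i => dh (lift ord0 i))).
Qed.

Lemma dop_derive q f p (x : R) : Ck q f -> (size p <= q)%N ->
  is_derive x (1 : R) (dop p f) (dop ('X * p) f x).
Proof.
move=> hf hp.
have -> : dop ('X * p) f x = \sum_(k < size p) p`_k * derive1n k.+1 f x.
  rewrite (@dop_widen _ (size p).+1) ?big_ord_recl /=; last first.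
    by rewrite (leq_trans (size_polyMleq _ _)) // size_polyX.
  rewrite coefXM /= mul0r add0r; apply: eq_bigr => k _.
  by rewrite coefXM.
apply: (is_derive_sum_ord (dh := fun k y => p`_k * derive1n k.+1 f y)) => k.
apply: is_derive_scale; apply: Ck_is_derive hf _.
exact: leq_trans (ltn_ord k) hp.
Qed.

End smooth.

(** * The identity for test functions with [f^(q)(F)] in L2 *)

Section stein_identity.
Context (R : realType) (q : nat) (alpha : 'I_q -> R)
  (d : measure_display) (T : measurableType d) (P : probability T R)
  (N : 'I_q -> {RV P >-> R}).
Hypothesis hN : iid_std_normal N.
Notation gamma := (normal_prob (0 : R) 1).
Notation F := (quad_target alpha N).

Lemma gaussian_growth_sum (I : Type) (r : seq I) (c : I -> R) (h : I -> R -> R) :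
  (forall i, gaussian_growth alpha (h i)) ->
  gaussian_growth alpha (fun x => \sum_(i <- r) c i * h i x).
Proof.
move=> hh theta K ht; elim: r => [|i r [C [C0 hC]]].
  by exists 0; split => // x rho _; rewrite big_nil normr0 mul0r.
have [D [D0 hD]] := hh i theta K ht.
exists (`|c i| * D + C); split => [|x rho hr]; first by rewrite addr_ge0 // mulr_ge0.
rewrite big_cons; apply: (le_trans (ler_normD _ _)).
rewrite mulrDl lerD ?hC // normrM -mulrA ler_wpM2l //; exact: hD.
Qed.

Lemma gaussian_growth_cst : gaussian_growth alpha (fun=> 1).
Proof.
move=> theta K ht; exists 1; split => // x rho _.
rewrite normr1 mul1r -expR0 ler_expR mulr_ge0 ?sumsq_ge0 //; lra.
Qed.

(** The identity map has admissible growth as an antiderivative of the constant 1. Positivity of [q]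
    supplies a coordinate, used with exponent 0. *)
Lemma integrable_target : (0 < q)%N -> P.-integrable setT (EFin \o F).
Proof.
move=> q0; have id_growth : gaussian_growth alpha (fun x => x).
  exact: growth_antiderivative (fun x => is_derive_id x (1 : R)) gaussian_growth_cst.
have cid : continuous (fun x : R => x) by move=> x; exact: cvg_id.
have := integrable_growth hN (Ordinal q0) (leq0n 2) cid id_growth.
by apply: eq_integrable => // w _ /=; rewrite mul1r.
Qed.

Variable f : R -> R.
Implicit Types (p : {poly R}).
Hypotheses (q0 : (0 < q)%N) (hf : Ck q f).
Hypothesis fL2 : (\int[P]_w (derive1n q f (F w) ^+ 2)%:E < +oo)%E.

(** Descending induction on the order: square integrability of [f^(q)(F)] gives the bound at order
    [q - 1], and each further step down is an antiderivative. *)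
Lemma derive_growth k : (k < q)%N -> gaussian_growth alpha (derive1n k f).
Proof.
move=> hk; rewrite -(subKn (ltnW hk)).
have : (0 < q - k <= q)%N by lia.
move: (q - k)%N => {hk}; elim=> [//|m IH /= hm].
have dd (x : R) : is_derive x (1 : R) (derive1n (q - m.+1) f) (derive1n (q - m) f x).
  have -> : (q - m = (q - m.+1).+1)%N by lia.
  by apply: Ck_is_derive hf _; lia.
case: m IH hm dd => [_ _|m IH hm] dd.
  apply: (growth_of_L2 dd); first by rewrite subn0; case: hf.
  move=> i _; rewrite subn0; apply: (exists_rest hN) => //.
  by case: hf.
apply: growth_antiderivative dd _; apply: IH; lia.
Qed.

Lemma dop_growth p : (size p <= q)%N -> gaussian_growth alpha (dop p f).
Proof.
move=> hp; apply: gaussian_growth_sum => k; apply: derive_growth.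
exact: leq_trans (ltn_ord k) hp.
Qed.

Lemma measurable_derive k : (k <= q)%N -> measurable_fun setT (fun w => derive1n k f (F w)).
Proof.
move=> hk; apply: measurableT_comp; last exact: measurable_target.
by apply: continuous_measurable; exact: Ck_continuous hf hk.
Qed.

(** Orders below [q] follow from growth. At order [q] only [|a b| <= a^2 + b^2] is available; the
    square of the coordinate factor is integrable by the growth of the constant 1. *)
Lemma integrable_derive k i m : (k <= q)%N -> (m <= 1)%N ->
  P.-integrable setT (EFin \o (fun w => (N i w ^+ 2) ^+ m * derive1n k f (F w))).
Proof.
move=> hk hm; case: (ltnP k q) => hkq.
  apply: (integrable_growth hN); first exact: leq_trans hm _.
    exact: Ck_continuous hf hk.
  exact: derive_growth.
have {hkq}-> : k = q by apply/eqP; rewrite eqn_leq hk.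
have mN : measurable_fun setT (fun w => (N i w ^+ 2) ^+ m).
  by apply: measurable_funX; apply: measurable_funX; exact: measurable_funP.
have i1 : P.-integrable setT (EFin \o (fun w => (N i w ^+ 2) ^+ (m * 2))).
  have hm2 : (m * 2 <= 2)%N by lia.
  have := integrable_growth hN i hm2 (@continuous_const R 1) gaussian_growth_cst.
  by apply: eq_integrable => // w _ /=; rewrite mulr1.
have i2 : P.-integrable setT (EFin \o (fun w => derive1n q f (F w) ^+ 2)).
  apply/integrableP; split.
    by apply/measurable_EFinP; apply: measurable_funX; exact: measurable_derive.
  by under eq_integral do rewrite /= ger0_norm ?sqr_ge0 //.
apply: le_integrable (integrableD measurableT i1 i2) => //.
  by apply/measurable_EFinP; apply: measurable_funM => //; exact: measurable_derive.
move=> w _ /=; rewrite lee_fin normrM exprM.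
set a := _ ^+ m; set b := derive1n q f _.
rewrite [leRHS]ger0_norm ?addr_ge0 ?sqr_ge0 //.
rewrite -(real_normK (num_real a)) -(real_normK (num_real b)).
have := normr_ge0 a; have := normr_ge0 b; have := sqr_ge0 (`|a| - `|b|); nra.
Qed.

Lemma integrable_dop p i m : (size p <= q.+1)%N -> (m <= 1)%N ->
  P.-integrable setT (EFin \o (fun w => (N i w ^+ 2) ^+ m * dop p f (F w))).
Proof.
move=> hp hm.
have : P.-integrable setT (fun w => \sum_(k < size p)
    (p`_k)%:E * (EFin \o (fun w => (N i w ^+ 2) ^+ m * derive1n k f (F w))%R) w)%E.
  apply: integrable_sum => // k _; apply: integrableZl => //.
  by apply: integrable_derive => //; rewrite -ltnS (leq_trans _ hp).
apply: eq_integrable => // w _ /=; rewrite /dop mulr_sumr -sumEFin.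
by apply: eq_bigr => k _; rewrite -EFinM; congr EFin; ring.
Qed.

Let E (h : T -> R) := \int[P]_w h w.

Let i0 : 'I_q := Ordinal q0.

Lemma integrable_dop0 p : (size p <= q.+1)%N ->
  P.-integrable setT (EFin \o (fun w => dop p f (F w))).
Proof.
move=> hp; have := integrable_dop i0 hp (leq0n 1).
by apply: eq_integrable => // w _ /=; rewrite expr0 mul1r.
Qed.

Lemma integrable_dop1 p i : (size p <= q.+1)%N ->
  P.-integrable setT (EFin \o (fun w => N i w ^+ 2 * dop p f (F w))).
Proof. by move=> hp; apply: (integrable_dop i hp (leqnn 1)). Qed.

Lemma integrable_dop2 p i : (size p <= q.+1)%N ->
  P.-integrable setT (EFin \o (fun w => (N i w ^+ 2 - 1) * dop p f (F w))).
Proof.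
move=> hp; have := integrableB measurableT (integrable_dop1 i hp) (integrable_dop0 hp).
by apply: eq_integrable => // w _ /=; rewrite mulrBl mul1r EFinB.
Qed.

Lemma expectation_coord i :
  E (fun w => (N i w ^+ 2 - 1) * dop (symbolA alpha) f (F w))
  = 2 * alpha i * E (fun w => dop ('X * cosymbol alpha i) f (F w)).
Proof.
set p := cosymbol alpha i; have hp : (size p <= q)%N := size_cosymbol _ _.
have hXp : (size ('X * p)%R <= q.+1)%N.
  by rewrite (leq_trans (size_polyMleq _ _)) // size_polyX.
have hp' : (size p <= q.+1)%N by exact: leqW.
have -> : E (fun w => (N i w ^+ 2 - 1) * dop (symbolA alpha) f (F w)) =
   E (fun w => (N i w ^+ 2 - 1) * dop p f (F w)
     - 2 * alpha i * ((N i w ^+ 2 - 1) * dop ('X * p) f (F w))).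
  have pA : symbolA alpha = p - (2 * alpha i) *: ('X * p).
    by rewrite (symbolAE _ i) -/p mulrBl mul1r -scalerAl.
  by apply: eq_Rintegral => w _; rewrite pA dopB dopZ; ring.
have iZ : P.-integrable setT (EFin \o (fun w => 2 * alpha i * ((N i w ^+ 2 - 1) * dop
  ('X * p) f (F w)))).
  apply: eq_integrable (integrableZl measurableT (2 * alpha i) (integrable_dop2 i hXp)) =>
    // w _.
rewrite /E RintegralB // ?RintegralZl //; try exact: integrable_dop2.
(* As [p] has size at most [q], [p(D) f] uses derivatives below [q] and has the required growth;
   ['X * p] may reach [f^(q)], where integrability is enough. *)
rewrite (target_ibp hN (fun x => dop_derive x hf hp) (dop_continuous hf hXp)
  (dop_growth hp) (integrable_dop2 i hp') (integrable_dop1 i hXp)).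
rewrite -mulrBr -RintegralB //; [|exact: integrable_dop1|exact: integrable_dop2].
by congr (_ * _); apply: eq_Rintegral => w _; rewrite -mulrBl; ring.
Qed.

Lemma Esum (I : Type) (r : seq I) (h : I -> T -> R) :
  (forall i, P.-integrable setT (EFin \o h i)) ->
  E (fun w => \sum_(i <- r) h i w) = \sum_(i <- r) E (h i).
Proof.
move=> hi; elim: r => [|i r IH].
  by rewrite big_nil /E; under eq_Rintegral do rewrite big_nil;
    rewrite Rintegral_cst ?mul0r.
rewrite big_cons -IH /E; under eq_Rintegral do rewrite big_cons.
rewrite RintegralD //.
apply: eq_integrable (@integrable_sum _ _ _ P setT measurableT _ r xpredT (fun i =>
  EFin \o h i) (fun i _ => hi i)) => // w _ /=.
by rewrite sumEFin.
Qed.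

Lemma stein_identity :
  (\int[P]_w (dop (symbolB alpha) f (F w) - F w * dop (symbolA alpha) f (F w))%:E = 0)%E.
Proof.
have iB := integrable_dop0 (size_symbolB alpha).
have sA := size_symbolA alpha.
have hX i : (size ('X * cosymbol alpha i)%R <= q.+1)%N.
  by rewrite (leq_trans (size_polyMleq _ _)) // size_polyX; exact: size_cosymbol.
have iA i : P.-integrable setT (EFin \o (fun w => alpha i * ((N i w ^+ 2 - 1) * dop
  (symbolA alpha) f (F w)))).
  by apply: eq_integrable (integrableZl measurableT (alpha i) (integrable_dop2 i sA)).
have FA w : F w * dop (symbolA alpha) f (F w)
    = \sum_i alpha i * ((N i w ^+ 2 - 1) * dop (symbolA alpha) f (F w)).
  by rewrite {1}/quad_target mulr_suml; apply: eq_bigr => i _; rewrite mulrA.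
have iFA : P.-integrable setT (EFin \o (fun w => F w * dop (symbolA alpha) f (F w))).
  apply: eq_integrable (@integrable_sum _ _ _ P setT measurableT _ (enum 'I_q) xpredT _
    (fun i _ => iA i)) => // w _ /=.
  by rewrite FA big_enum -sumEFin.
have h0 : E (fun w => dop (symbolB alpha) f (F w) - F w * dop (symbolA alpha) f (F w)) = 0.
  rewrite /E RintegralB //; apply/eqP; rewrite subr_eq0; apply/eqP.
  under [RHS]eq_Rintegral do rewrite FA.
  rewrite -/(E _) -/(E _) [RHS]Esum //.
  have -> : E (fun w => dop (symbolB alpha) f (F w)) =
     E (fun w => \sum_i (2 * alpha i ^+ 2) * dop ('X * cosymbol alpha i) f (F w)).
    apply: eq_Rintegral => w _; rewrite dop_sum.
    by apply: eq_bigr => i _; rewrite dopZ.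
  have iX i : P.-integrable setT (EFin \o (fun w => (2 * alpha i ^+ 2) * dop
    ('X * cosymbol alpha i) f (F w))).
    by apply: eq_integrable (integrableZl measurableT (2 * alpha i ^+ 2) (integrable_dop0
      (hX i))).
  rewrite Esum //; apply: eq_bigr => i _.
  rewrite /E !RintegralZl //; [|exact: integrable_dop2|exact: integrable_dop0].
  by rewrite -/(E _) -/(E _) expectation_coord; ring.
have iall : P.-integrable setT (EFin \o (fun w => dop (symbolB alpha) f (F w) - F w * dop
  (symbolA alpha) f (F w))).
  by apply: eq_integrable (integrableB measurableT iB iFA).
rewrite -[LHS]fineK; last exact: integrable_fin_num.
by move: h0; rewrite /E /Rintegral => ->.
Qed.

End stein_identity.

(** * Cumulants of the target *)

Section cumulants.
Context (R : realType) (q : nat) (alpha : 'I_q -> R)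
  (d : measure_display) (T : measurableType d) (P : probability T R)
  (N : 'I_q -> {RV P >-> R}).
Hypothesis hN : iid_std_normal N.
Notation F := (quad_target alpha N).

(** Within this radius [2 |alpha_j t| < 1] for all [j], where the closed form of the moment
    generating function is valid; the added 1 keeps the denominator positive. *)
Let radius : R := (2 * (1 + \sum_j `|alpha j|))^-1.

Lemma sum_norm_ge0 : 0 <= \sum_j `|alpha j|. Proof. exact: sumr_ge0. Qed.

Let radius_gt0 : 0 < radius.
Proof. by rewrite invr_gt0; have := sum_norm_ge0; lra. Qed.

Let small j (t : R) : `|t| < radius -> 0 < 1 - 2 * alpha j * t.
Proof.
move=> ht; have hj : `|alpha j| <= \sum_j `|alpha j|.
  by rewrite (bigD1 j) //= lerDl sumr_ge0.
have : `|2 * alpha j * t| < 1.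
  rewrite normrM [X in X * _]normrM (ger0_norm (ler0n _ 2)).
  have S0 := sum_norm_ge0.
  have : `|t| * (2 * (1 + \sum_j `|alpha j|)) < 1.
    by rewrite -ltr_pdivlMr ?mul1r //; lra.
  have := normr_ge0 t; nra.
by rewrite ltr_norml; lra.
Qed.

Lemma inv_sqrtE (u : R) : 0 < u -> (Num.sqrt u)^-1 = expR (- (1 / 2) * ln u).
Proof.
move=> u0; rewrite mulNr expRN; congr (_^-1).
have {1}-> : u = expR (1 / 2 * ln u) ^+ 2.
  by rewrite expr2 -expRD -mulrDl (_ : 1 / 2 + 1 / 2 = 1) ?mul1r ?lnK //; field.
by rewrite sqrtr_sqr ger0_norm // expR_ge0.
Qed.

(** Independence gives the product of [exp(- alpha_j t) (1 - 2 alpha_j t)^(-1/2)], and the logarithm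
    makes it a sum. *)
Lemma ln_mgf (t : R) : `|t| < radius ->
  ln (fine ('M_P F t)) = \sum_j (- alpha j * t - 1 / 2 * ln (1 - 2 * alpha j * t)).
Proof.
move=> ht.
have -> : ('M_P F t = (expR (\sum_j (- alpha j * t - 1 / 2 * ln
  (1 - 2 * alpha j * t))))%:E)%E.
  rewrite /mmt_gen_fun unlock.
  transitivity (\int[P]_w ((expR (- t * \sum_j alpha j))%:E *
     (expR (\sum_j (t * alpha j) * N j w ^+ 2))%:E))%E.
    apply: eq_integral => w _; rewrite -EFinM -expRD /= /quad_target; congr (expR _)%:E.
    rewrite mulr_suml mulr_sumr -big_split; apply: eq_bigr => j _ /=; ring.
  rewrite ge0_integralZl //; last first.
    apply/measurable_EFinP; apply: measurableT_comp => //.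
    apply: measurable_sum => j; apply: measurable_funM => //.
    by apply: measurable_funX; exact: measurable_funP.
  rewrite (sumsq_mgf hN); last by move=> j; have := small j ht; lra.
  rewrite -EFinM; congr EFin.
  under eq_bigr => j _.
    have -> : 1 - 2 * (t * alpha j) = 1 - 2 * alpha j * t by ring.
    rewrite inv_sqrtE ?small //; over.
  rewrite -expR_sum -expRD mulr_sumr -big_split; congr expR.
  by apply: eq_bigr => j _ /=; ring.
by rewrite /= expRK.
Qed.

Lemma is_derive_inv_affine_pow (a t : R) r : 1 - a * t != 0 ->
  is_derive t (1 : R) (fun s => (1 - a * s)^-1 ^+ r) (r%:R * a * (1 - a * t)^-1 ^+ r.+1).
Proof.
move=> h0; have dv : is_derive t (1 : R) (fun s => (1 - a * s)^-1) (a *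
  (1 - a * t)^-1 ^+ 2).
  have du : is_derive t (1 : R) (fun s => 1 - a * s) (- a).
    have -> : (fun s => 1 - a * s) = (fun s => - a * s + 1) by apply/funext => s; ring.
    exact: is_derive_affine.
  apply: (@is_derive_eq _ _ _ _ _ _ _ _ (@is_deriveV _ (fun s => 1 - a * s) t _ _ h0 du)).
  by rewrite /GRing.scale /= mulrNN mulrC exprVn.
elim: r => [|r IH].
  by rewrite !mul0r; under eq_fun do rewrite expr0; exact: is_derive_cst.
under eq_fun do rewrite exprS.
apply: (@is_derive_eq _ _ _ _ _ _ _ _ (is_derive_mul dv IH)).
by rewrite -[r.+1]addn1 natrD !addn1 !exprS; ring.
Qed.

(** The closed form holds only inside the radius, so repeated differentiation needs it near every
    point of that interval and not merely at 0. *)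
Lemma derive1_near (g h : R -> R) (t a : R) : `|t| < radius ->
  (forall s, `|s| < radius -> g s = h s) -> is_derive t (1 : R) h a -> derive1 g t = a.
Proof.
move=> ht gh hd; rewrite derive1E.
rewrite (@near_eq_derive _ _ _ g h); first by case: hd.
have : \forall s \near t, `|s| < radius.
  have /cvgr_lt : (fun s : R => `|s|) @ t --> `|t| by exact: norm_continuous.
  exact.
by apply: filterS => s; exact: gh.
Qed.

(** The induction starts at the second derivative: the first still carries the constants
    [- alpha_j], and afterwards only powers of [1 / (1 - 2 alpha_j t)] remain. *)
Lemma derive_ln_mgf r (t : R) : `|t| < radius ->
  derive1n r.+2 (fun t => ln (fine ('M_P F t))) t
  = \sum_j (r.+1`!%:R * 2 ^+ r.+1 * alpha j ^+ r.+2) * (1 - 2 * alpha j * t)^-1 ^+ r.+2.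
Proof.
elim: r t => [|r IH] t ht.
  have h1 s : `|s| < radius -> derive1n 1 (fun t => ln (fine ('M_P F t))) s
      = \sum_j (- alpha j + alpha j * (1 - 2 * alpha j * s)^-1 ^+ 1).
    move=> hs; rewrite derive1n1; apply: (derive1_near hs ln_mgf).
    apply: (is_derive_sum_ord (h := fun j s => - alpha j * s - 1 / 2 * ln
      (1 - 2 * alpha j * s))
      (dh := fun j s => - alpha j + alpha j * (1 - 2 * alpha j * s)^-1 ^+ 1)) => j.
    have dl : is_derive s (1 : R) (fun s => ln (1 - 2 * alpha j * s))
      ((1 - 2 * alpha j * s)^-1 * - (2 * alpha j)).
      have du : is_derive s (1 : R) (fun s => 1 - 2 * alpha j * s) (- (2 * alpha j)).
        have -> : (fun s => 1 - 2 * alpha j * s) = (fun s => -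
          (2 * alpha j) * s + 1) by apply/funext => z; ring.
        exact: is_derive_affine.
      exact: (@is_derive1_comp _ (@ln R) (fun s => 1 - 2 * alpha j * s) s _ _
        (is_derive1_ln (small j hs)) du).
    have -> : (fun s => - alpha j * s - 1 / 2 * ln (1 - 2 * alpha j * s)) =
       (fun s => (- alpha j * s + 0) + (- (1 / 2)) * ln (1 - 2 * alpha j * s)).
      by apply/funext => z; ring.
    apply: (@is_derive_eq _ _ _ _ _ _ _ _ (is_derive_add (is_derive_affine
      (- alpha j) 0 s) (is_derive_scale (- (1 / 2)) dl))).
    by rewrite expr1; field; rewrite gt_eqF // small.
  rewrite derive1nS; apply: (derive1_near ht h1).
  apply: (is_derive_sum_ord (h := fun j s => - alpha j + alpha j *
    (1 - 2 * alpha j * s)^-1 ^+ 1)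
      (dh := fun j s => (1`!%:R * 2 ^+ 1 * alpha j ^+ 2) *
        (1 - 2 * alpha j * s)^-1 ^+ 2)) => j.
  have nz : 1 - 2 * alpha j * t != 0 by rewrite gt_eqF // small.
  apply: (@is_derive_eq _ _ _ _ _ _ _ _ (is_derive_add (is_derive_cst (- alpha j) t 1)
    (is_derive_scale (alpha j) (is_derive_inv_affine_pow 1 nz)))).
  by rewrite add0r (_ : 1`! = 1%N) // !expr1; ring.
rewrite derive1nS; apply: (derive1_near ht IH).
apply: (is_derive_sum_ord
  (h := fun j s => (r.+1`!%:R * 2 ^+ r.+1 * alpha j ^+ r.+2) *
    (1 - 2 * alpha j * s)^-1 ^+ r.+2)
  (dh := fun j s => (r.+2`!%:R * 2 ^+ r.+2 * alpha j ^+ r.+3) *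
    (1 - 2 * alpha j * s)^-1 ^+ r.+3)) => j.
have nz : 1 - 2 * alpha j * t != 0 by rewrite gt_eqF // small.
apply: (@is_derive_eq _ _ _ _ _ _ _ _ (is_derive_scale _
  (is_derive_inv_affine_pow r.+2 nz))).
by rewrite (factS r.+1) natrM [2 ^+ r.+2]exprS [alpha j ^+ r.+3]exprS; ring.
Qed.

Lemma cumulant_target m : cumulant P F m.+2
  = m.+1`!%:R * 2 ^+ m.+1 * \sum_(i < q) alpha i ^+ m.+2.
Proof.
rewrite /cumulant derive_ln_mgf ?normr0 // mulr_sumr; apply: eq_bigr => j _.
by rewrite mulr0 subr0 invr1 expr1n mulr1.
Qed.

End cumulants.

(** * Trigonometric test functions *)

Section trigonometric_test_functions.
Context (R : realType).
Implicit Types (f : R -> R) (p r : {poly R}).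

Lemma derive1n_dop f p j : (forall n, Ck n f) ->
  derive1n j (dop p f) = dop ('X^j * p) f.
Proof.
move=> hf; elim: j => [|j IH]; first by rewrite expr0 mul1r.
rewrite derive1nS IH; apply/funext => x; rewrite derive1E.
have := dop_derive x (hf (size ('X^j * p))) (leqnn _).
by case=> _ ->; rewrite mulrA -exprS.
Qed.

Lemma dop_Ck f p n : (forall n, Ck n f) -> Ck n (dop p f).
Proof.
move=> hf; split=> [j x hj|]; rewrite derive1n_dop //.
  by have := dop_derive x (hf (size ('X^j * p))) (leqnn _); case.
exact: dop_continuous (hf (size ('X^n * p)%R)) (leqnSn _).
Qed.

Lemma dop_mul f p r x : (forall n, Ck n f) -> dop r (dop p f) x = dop (r * p) f x.
Proof.
move=> hf; rewrite {1}/dop; under eq_bigr do rewrite derive1n_dop // -dopZ scalerAl.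
by rewrite -dop_sum -mulr_suml -poly_def coefK.
Qed.

(** The free phase makes the family stable under differentiation, each derivative adding [pi / 2],
    and covers cosines and sines together. *)
Definition wave (xi c x : R) : R := cos (xi * x + c).

Lemma derive1n_wave (xi c : R) k :
  derive1n k (wave xi c) = fun x => xi ^+ k * cos (xi * x + (c + k%:R * (pi / 2))).
Proof.
elim: k => [|k IH]; apply/funext => x; first by rewrite /wave /= mul0r addr0 expr0 mul1r.
rewrite derive1nS IH derive1E.
have := is_derive_scale (xi ^+ k) (is_derive1_comp
  (is_derive_cos _) (is_derive_affine xi (c + k%:R * (pi / 2)) x)).
case=> _ ->; have -> : c + k.+1%:R * (pi / 2) = c + k%:R * (pi / 2) + pi / 2 by field.
rewrite [xi * x + (_ + pi / 2)]addrA cosDpihalf exprS.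
ring.
Qed.

Lemma wave_Ck (xi c : R) n : Ck n (wave xi c).
Proof.
split=> [j x hj|]; rewrite derive1n_wave.
  by have := is_derive_scale (xi ^+ j) (is_derive1_comp
    (is_derive_cos _) (is_derive_affine xi (c + j%:R * (pi / 2)) x)); case.
apply: continuous_mul; first exact: continuous_const.
move=> x; apply: continuous_comp; last exact: continuous_cos.
exact: is_derive_continuous (is_derive_affine xi (c + n%:R * (pi / 2))) x.
Qed.

Definition wave_bound p (xi : R) := \sum_(k < size p) `|p`_k| * `|xi| ^+ k.

(** Real part of [p(i xi)], since [i^k = cos(k pi/2) + i sin(k pi/2)]; [wave_sin] is minus the
    imaginary part. *)
Definition wave_cos p (xi : R) := \sum_(k < size p) p`_k * xi ^+ k * cos (k%:R * (pi / 2)).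
Definition wave_sin p (xi : R) := - \sum_(k < size p) p`_k * xi ^+ k * sin (k%:R *
  (pi / 2)).

Lemma dop_wave_bound p (xi c x : R) : `|dop p (wave xi c) x| <= wave_bound p xi.
Proof.
rewrite /dop; apply: (le_trans (ler_norm_sum _ _ _)); apply: ler_sum => k _.
rewrite derive1n_wave normrM ler_wpM2l // normrM normrX ler_piMr ?exprn_ge0 //.
exact: cos_max.
Qed.

(** Uniform over [|xi| <= M], as needed to bound a coefficient of the differential equation on an
    interval. *)
Lemma wave_sin_bound p (xi M : R) : `|xi| <= M -> `|wave_sin p xi| <= wave_bound p M.
Proof.
move=> hM; have M0 : 0 <= M by exact: le_trans hM.
rewrite normrN; apply: (le_trans (ler_norm_sum _ _ _)); apply: ler_sum => k _.
rewrite !normrM -mulrA ler_wpM2l // normrX (ger0_norm M0).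
apply: (@le_trans _ _ (`|xi| ^+ k)); last by rewrite lerXn2r ?nnegrE.
by rewrite ler_piMr ?exprn_ge0 // sin_max.
Qed.

Lemma dop_wave p (xi c x : R) : dop p (wave xi c) x
  = wave_cos p xi * cos (xi * x + c) + wave_sin p xi * sin (xi * x + c).
Proof.
rewrite /dop /wave_sin mulNr !mulr_suml -sumrB; apply: eq_bigr => k _.
by rewrite derive1n_wave addrA cosD; ring.
Qed.

Lemma dopX2_wave p (xi c x : R) :
  dop ('X^2 * p) (wave xi c) x = - xi ^+ 2 * dop p (wave xi c) x.
Proof.
rewrite (@dop_widen _ (size p).+2) ?[in LHS]big_ord_recl ?big_ord_recl /=; last first.
  by rewrite (leq_trans (size_polyMleq _ _)) // size_polyXn.
rewrite !coefXnM /= !mul0r !add0r /dop mulr_sumr; apply: eq_bigr => k _.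
transitivity (p`_k * derive1n k.+2 (wave xi c) x);
  first by rewrite (_ : bump 0 (bump 0 k) = k.+2) // coefXnM /= subn2 add0n.
rewrite !derive1n_wave.
rewrite exprS [xi ^+ k.+1]exprS (_ : c + k.+2%:R * (pi / 2) = c + k%:R * (pi / 2) + pi);
  last by field.
by rewrite addrA cosDpi; ring.
Qed.

Variables (q : nat) (alpha : 'I_q -> R).

(* Multiplying [symbolA] by this factor makes it a polynomial in [D ^ 2], which
   acts on [cos (xi x + c)] as the scalar [symbol_abs xi]. *)
Definition symbolA_conj : {poly R} := \prod_(j < q) (1 + (2 * alpha j) *: 'X).

Definition symbol_abs (xi : R) : R := \prod_(j < q) (1 + (2 * alpha j * xi) ^+ 2).

(** It keeps the coefficients of the differential equation, which have this denominator, free of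
    poles. *)
Lemma symbol_abs_ge1 xi : 1 <= symbol_abs xi.
Proof.
rewrite /symbol_abs; elim/big_ind: _ => // [x y hx hy|j _].
  by rewrite -[1]mulr1 ler_pM.
by rewrite lerDl sqr_ge0.
Qed.

(** Each pair of factors is [1 - (2 alpha_j)^2 X^2], and [D^2] acts on the wave as [- xi^2]. *)
Lemma dop_symbolA_conj (xi c x : R) :
  dop (symbolA alpha * symbolA_conj) (wave xi c) x = symbol_abs xi * wave xi c x.
Proof.
rewrite /symbolA /symbolA_conj -big_split /=.
rewrite /symbol_abs; elim: (index_enum _) => [|j s IH].
  by rewrite !big_nil mul1r /dop size_poly1 big_ord1 coefC mul1r.
rewrite !big_cons; set p : {poly R} := \prod_(i <- s) _.
have -> : (1 - (2 * alpha j) *: 'X) * (1 + (2 * alpha j) *: 'X) * p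
   = p - (2 * alpha j) ^+ 2 *: ('X^2 * p).
  by set e := 2 * alpha j; rewrite -!mul_polyC rmorphXn /=; ring.
rewrite dopB dopZ dopX2_wave IH; ring.
Qed.

End trigonometric_test_functions.

(** * Characteristic functions *)

Section parameter_integral.
Context (R : realType) (d : measure_display) (T : measurableType d) (P : probability T R).

Lemma is_derive_expectation (f df : R -> T -> R) (G : T -> R) (x : R) :
  (forall y, P.-integrable setT (EFin \o f y)) ->
  (forall y w, is_derive y (1 : R) (f ^~ w) (df y w)) ->
  P.-integrable setT (EFin \o G) -> (forall y w, `|df y w| <= G w) ->
  is_derive x (1 : R) (fun y => \int[P]_w f y w) (\int[P]_w df x w).
Proof.
move=> intf dfE intG dfG.
have G0 w : 0 <= G w by exact: le_trans (dfG x w).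
(* The majorant [G] is valid for every parameter, so any open interval around [x] would do. *)
have xI : `]x - 1, x + 1[%classic x by rewrite /= in_itv /=; apply/andP; split; lra.
have hd y w : `]x - 1, x + 1[%classic y -> setT w -> derivable (f ^~ w) y 1.
  by move=> _ _; case: (dfE y w).
have pE y w : partial1of2 f y w = df y w.
  by rewrite partial1of2E; case: (dfE y w).
have hG y w : `]x - 1, x + 1[%classic y -> setT w -> `|partial1of2 f y w| <= G w.
  by move=> _ _; rewrite pE.
have hi y : `]x - 1, x + 1[%classic y -> P.-integrable setT (EFin \o f y) by [].
have h1 := derivable_under_integral measurableT xI hi hd G0 intG hG.
have h2 := differentiation_under_integral measurableT xI hi hd G0 intG hG.
apply: DeriveDef; first exact: h1.
by rewrite -derive1E h2; apply: eq_Rintegral => w _.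
Qed.

Lemma bounded_integrable (f : T -> R) (C : R) : measurable_fun setT f ->
  (forall w, `|f w| <= C) -> P.-integrable setT (EFin \o f).
Proof.
move=> mf hf; apply: (@le_integrable _ _ _ _ _ _ _ (EFin \o cst C)) => //.
- exact/measurable_EFinP.
- by move=> w _ /=; rewrite lee_fin; apply: le_trans (hf w) (ler_norm _).
- by apply: finite_measure_integrable_cst.
Qed.

End parameter_integral.

(** * Real and imaginary parts of the characteristic function *)

Section wave_expectation.
Context (R : realType) (d : measure_display) (T : measurableType d) (P : probability T R)
  (Y : {RV P >-> R}).
Hypothesis intY : P.-integrable setT (EFin \o Y).

Definition Ecos (xi : R) := \int[P]_w cos (xi * Y w).
Definition Esin (xi : R) := \int[P]_w sin (xi * Y w).

Lemma measurable_RV_comp (h : R -> R) : continuous h -> measurable_fun setT (fun w => h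
  (Y w)).
Proof. by move=> ch; apply: measurableT_comp; [exact: continuous_measurable|exact:
  measurable_funP]. Qed.

Lemma continuous_affine_comp (h : R -> R) (a b : R) : continuous h -> continuous (fun x =>
  h (a * x + b)).
Proof.
move=> ch x; apply: continuous_comp; last exact: ch.
exact: is_derive_continuous (is_derive_affine a b) x.
Qed.

Lemma integrable_affine_comp (h : R -> R) (xi c : R) : continuous h -> (forall x,
  `|h x| <= 1) ->
  P.-integrable setT (EFin \o (fun w => h (xi * Y w + c))).
Proof.
move=> ch hh; apply: (@bounded_integrable _ _ _ _ _ 1) => //.
by apply: (@measurable_RV_comp (fun x => h (xi * x + c))); exact: continuous_affine_comp.
Qed.

Lemma integrable_RV_affine_comp (h : R -> R) (xi c : R) : continuous h -> (forall x,
  `|h x| <= 1) ->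
  P.-integrable setT (EFin \o (fun w => Y w * h (xi * Y w + c))).
Proof.
move=> ch hh; apply: le_integrable intY => //.
  apply/measurable_EFinP; apply: measurable_funM; first exact: measurable_funP.
  by apply: (@measurable_RV_comp (fun x => h (xi * x + c))); exact: continuous_affine_comp.
by move=> w _ /=; rewrite lee_fin normrM ler_piMr.
Qed.

(** Differentiation under the integral with majorant [|Y|]; stated for general [h] so that cosine
    and sine share it. *)
Lemma is_derive_affine_comp (h dh : R -> R) (xi : R) : continuous h -> continuous dh ->
  (forall x, `|h x| <= 1) -> (forall x, `|dh x| <= 1) ->
  (forall x : R, is_derive x (1 : R) h (dh x)) ->
  is_derive xi (1 : R) (fun y => \int[P]_w h (y * Y w)) (\int[P]_w (Y w * dh (xi * Y w))).
Proof.
move=> ch cdh hh hdh hd.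
apply: (@is_derive_expectation _ _ _ _ (fun y w => h (y * Y w))
  (fun y w => Y w * dh (y * Y w)) (fun w => `|Y w|)).
- move=> y; have := integrable_affine_comp y 0 ch hh.
  by apply: eq_integrable => // w _ /=; rewrite addr0.
- move=> y w; have e : (fun y => h (y * Y w)) = h \o (fun y => Y w * y + 0).
    by apply/funext => z /=; rewrite addr0 mulrC.
  rewrite e; apply: (@is_derive_eq _ _ _ _ _ _ _ _ (is_derive1_comp (hd _)
    (is_derive_affine (Y w) 0 y))).
  by rewrite addr0 mulrC [Y w * y]mulrC.
- exact: integrable_norm.
- by move=> y w; rewrite normrM ler_piMr.
Qed.

Lemma is_derive_Ecos xi : is_derive xi (1 : R) Ecos (- \int[P]_w (Y w * sin (xi * Y w))).
Proof.
have cN : continuous (fun x : R => - sin x).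
  by move=> x; apply: cvgN; exact: continuous_sin.
have sN (x : R) : `|- sin x| <= 1 by rewrite normrN; exact: sin_max.
have h := is_derive_affine_comp xi (@continuous_cos R) cN (fun x => cos_max x) sN
  (fun x => is_derive_cos x).
apply: (@is_derive_eq _ _ _ _ _ _ _ _ h).
under eq_Rintegral do rewrite mulrN -mulN1r.
rewrite RintegralZl ?mulN1r //.
have := integrable_RV_affine_comp xi 0 (@continuous_sin R) (fun x => sin_max x).
by apply: eq_integrable => // w _ /=; rewrite addr0.
Qed.

Lemma is_derive_Esin xi : is_derive xi (1 : R) Esin (\int[P]_w (Y w * cos (xi * Y w))).
Proof.
exact: (is_derive_affine_comp xi (@continuous_sin R) (@continuous_cos R)
  (fun x => sin_max x) (fun x => cos_max x) (fun x => is_derive_sin x)).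
Qed.

Lemma Ecos0 : Ecos 0 = 1.
Proof.
rewrite /Ecos; under eq_Rintegral do rewrite mul0r cos0.
by rewrite Rintegral_cst // mul1r [X in fine X](_ : _ = 1%E) //; exact: probability_setT.
Qed.

Lemma Esin0 : Esin 0 = 0.
Proof.
by rewrite /Esin; under eq_Rintegral do rewrite mul0r sin0; rewrite Rintegral_cst // mul0r.
Qed.

Lemma Ecos_opp xi : Ecos (- xi) = Ecos xi.
Proof. by apply: eq_Rintegral => w _; rewrite mulNr cosN. Qed.

Lemma Esin_opp xi : Esin (- xi) = - Esin xi.
Proof.
rewrite /Esin -[RHS]mulN1r -RintegralZl //.
  by apply: eq_Rintegral => w _; rewrite mulNr sinN mulN1r.
have := integrable_affine_comp xi 0 (@continuous_sin R) (fun x => sin_max x).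
by apply: eq_integrable => // w _ /=; rewrite addr0.
Qed.

End wave_expectation.

(** * Uniqueness for the linear system *)

Section wave_ode.
Context (R : realType).

(* If (u, v) solves u' = n u - m v, v' = m u + n v then w = u^2 + v^2 solves
   w' = 2 n w, so w vanishes as soon as it vanishes at 0. *)
Lemma rotation_ode_unique (u v m n : R -> R) (M K : R) : 0 <= M ->
  (forall x : R, is_derive x (1 : R) u (n x * u x - m x * v x)) ->
  (forall x : R, is_derive x (1 : R) v (m x * u x + n x * v x)) ->
  u 0 = 0 -> v 0 = 0 -> (forall x, 0 <= x <= M -> n x <= K) ->
  u M = 0 /\ v M = 0.
Proof.
move=> M0 du dv u0 v0 hn.
pose w x := u x * u x + v x * v x.
have dw (x : R) : is_derive x (1 : R) w (2 * n x * w x).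
  apply: (@is_derive_eq _ _ _ _ _ _ _ _ (is_derive_add (is_derive_mul (du x) (du x))
    (is_derive_mul (dv x) (dv x)))).
  by rewrite /w; ring.
(* Gronwall's device: [z' = 2 (n - K) z] is nonpositive on [0, M], so the mean value theorem gives
   [z M <= z 0 = 0] without integrating [n]. *)
pose z x := w x * expR (- (2 * K) * x + 0).
have dz (x : R) : is_derive x (1 : R) z (2 * (n x - K) * z x).
  apply: (@is_derive_eq _ _ _ _ _ _ _ _ (is_derive_mul (dw x)
    (is_derive1_comp (is_derive_expR _) (is_derive_affine (- (2 * K)) 0 x)))).
  by rewrite /z /=; ring.
have w0 x : 0 <= w x by rewrite addr_ge0 // -expr2 sqr_ge0.
have z0 x : 0 <= z x by rewrite mulr_ge0 ?expR_ge0.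
have [c cM hc] := MVT_segment M0 (fun x _ => dz x)
  (continuous_subspaceT (is_derive_continuous dz)).
have zM : z M <= 0.
  have : z 0 = 0 by rewrite /z /w u0 v0 !mul0r addr0 mul0r.
  have := hn c; move: cM; rewrite in_itv /= => cM /(_ cM) hK zz.
  move: hc; rewrite zz !subr0 => ->.
  by rewrite mulr_le0_ge0 // mulr_le0_ge0 //; lra.
have : w M = 0.
  have : z M = 0 by apply/eqP; rewrite eq_le zM z0.
  by move/eqP; rewrite mulf_eq0 [expR _ == 0]gt_eqF ?expR_gt0 // orbF => /eqP.
move/eqP; rewrite paddr_eq0 -?expr2 ?sqr_ge0 // !sqrf_eq0.
by case/andP => /eqP -> /eqP ->.
Qed.

End wave_ode.

(** * The differential equation of the characteristic function *)

Section wave_stein.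
Context (R : realType) (q : nat) (alpha : 'I_q -> R).
Context (d : measure_display) (T : measurableType d) (P : probability T R)
  (Y : {RV P >-> R}).
Hypothesis intY : P.-integrable setT (EFin \o Y).

(** A class containing the trigonometric test functions, on which every moment condition follows
    from integrability of [Y]. *)
Definition bounded_derivatives (f : R -> R) :=
  exists C, forall k x, (k <= q)%N -> `|derive1n k f x| <= C.

Hypothesis steinY : forall f, Ck q f -> bounded_derivatives f ->
  (\int[P]_w (dop (symbolB alpha) f (Y w) - Y w * dop (symbolA alpha) f (Y w))%:E = 0)%E.

(** [S(i xi) / symbol_abs xi] equals [B(i xi) / A(i xi)], with the complex denominator cleared by
    its conjugate. *)
Let S : {poly R} := symbolB alpha * symbolA_conj alpha.

Lemma dop_wave_bounded_derivatives (p : {poly R}) (xi c : R) :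
  bounded_derivatives (dop p (wave xi c)).
Proof.
exists (\sum_(k < q.+1) wave_bound ('X^k * p) xi) => k x; rewrite -ltnS => hk.
rewrite derive1n_dop; last by move=> n; exact: wave_Ck.
apply: (le_trans (dop_wave_bound _ _ _ _)).
rewrite (bigD1 (Ordinal hk)) //= lerDl sumr_ge0 // => j _.
by apply: sumr_ge0 => l _; rewrite mulr_ge0 // exprn_ge0.
Qed.

Lemma wave_stein (xi c : R) :
  symbol_abs alpha xi * \int[P]_w (Y w * cos (xi * Y w + c)) =
  wave_cos S xi * \int[P]_w cos (xi * Y w + c) +
  wave_sin S xi * \int[P]_w sin (xi * Y w + c).
Proof.
have wc n : Ck n (wave xi c) := wave_Ck xi c n.
have := steinY (dop_Ck (symbolA_conj alpha) q wc) (dop_wave_bounded_derivatives _ xi c).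
have i1 := integrable_affine_comp Y xi c (@continuous_cos R) (fun x =>
  cos_max x) : P.-integrable setT (EFin \o (fun w => cos (xi * Y w + c))).
have i2 := integrable_affine_comp Y xi c (@continuous_sin R) (fun x =>
  sin_max x) : P.-integrable setT (EFin \o (fun w => sin (xi * Y w + c))).
have i3 := integrable_RV_affine_comp intY xi c (@continuous_cos R) (fun x => cos_max x).
have iZ (a : R) (f : T -> R) : P.-integrable setT (EFin \o f) -> P.-integrable setT
  (EFin \o (fun w => a * f w)).
  by move=> hf; apply: eq_integrable (integrableZl measurableT a hf).
move=> h; have {h} : \int[P]_w ((wave_cos S xi * cos (xi * Y w + c) + wave_sin S xi * sin
  (xi * Y w + c))
   - symbol_abs alpha xi * (Y w * cos (xi * Y w + c))) = 0.
  rewrite /Rintegral -[RHS](_ : fine 0%E = 0) // -h; congr fine.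
  apply: eq_integral => w _; congr EFin.
  by rewrite !dop_mul // dop_symbolA_conj -/S dop_wave /wave; ring.
rewrite RintegralB //; [|by apply: eq_integrable (integrableD measurableT (iZ
  (wave_cos S xi) _ i1) (iZ (wave_sin S xi) _ i2))|exact: iZ].
rewrite RintegralD //; [|exact: iZ|exact: iZ].
by rewrite !RintegralZl // => /eqP; rewrite subr_eq0 => /eqP.
Qed.

Lemma Ecos_ode (xi : R) : is_derive xi (1 : R) (Ecos Y)
  (wave_sin S xi / symbol_abs alpha xi * Ecos Y xi - wave_cos S xi / symbol_abs alpha xi *
    Esin Y xi).
Proof.
have s0 : symbol_abs alpha xi != 0 by rewrite gt_eqF // (lt_le_trans ltr01
  (symbol_abs_ge1 _ _)).
apply: (@is_derive_eq _ _ _ _ _ _ _ _ (is_derive_Ecos intY xi)).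
(* This phase turns the cosine into a sine, as the derivative of [Ecos] requires. *)
have := wave_stein xi (- (pi / 2)).
under eq_Rintegral do rewrite cosBpihalf.
under [in X in _ = X + _ -> _]eq_Rintegral do rewrite cosBpihalf.
under [in X in _ = _ + X -> _]eq_Rintegral do rewrite sinBpihalf -mulN1r.
rewrite RintegralZl //; last first.
  have := integrable_affine_comp Y xi 0 (@continuous_cos R) (fun x =>
    cos_max x) : P.-integrable setT (EFin \o (fun w => cos (xi * Y w + 0))).
  by apply: eq_integrable => // w _ /=; rewrite addr0.
rewrite -/(Ecos Y xi) -/(Esin Y xi) => h.
by apply: (mulfI s0); rewrite mulrN h; field.
Qed.

Lemma Esin_ode (xi : R) : is_derive xi (1 : R) (Esin Y)
  (wave_cos S xi / symbol_abs alpha xi * Ecos Y xi + wave_sin S xi / symbol_abs alpha xi *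
    Esin Y xi).
Proof.
have s0 : symbol_abs alpha xi != 0 by rewrite gt_eqF // (lt_le_trans ltr01
  (symbol_abs_ge1 _ _)).
apply: (@is_derive_eq _ _ _ _ _ _ _ _ (is_derive_Esin intY xi)).
have := wave_stein xi 0.
under eq_Rintegral do rewrite addr0.
under [in X in _ = X + _ -> _]eq_Rintegral do rewrite addr0.
under [in X in _ = _ + X -> _]eq_Rintegral do rewrite addr0.
rewrite -/(Ecos Y xi) -/(Esin Y xi) => h.
by apply: (mulfI s0); rewrite h; field.
Qed.

End wave_stein.

Section same_waves.
Context (R : realType) (q : nat) (alpha : 'I_q -> R).
Context (d : measure_display) (T : measurableType d) (P : probability T R)
  (Y : {RV P >-> R}) (intY : P.-integrable setT (EFin \o Y)).
Context (d' : measure_display) (T' : measurableType d') (P' : probability T' R)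
  (Y' : {RV P' >-> R}) (intY' : P'.-integrable setT (EFin \o Y')).
Hypothesis steinY : forall f, Ck q f -> bounded_derivatives q f ->
  (\int[P]_w (dop (symbolB alpha) f (Y w) - Y w * dop (symbolA alpha) f (Y w))%:E = 0)%E.
Hypothesis steinY' : forall f, Ck q f -> bounded_derivatives q f ->
  (\int[P']_w (dop (symbolB alpha) f (Y' w) - Y' w * dop (symbolA alpha) f
    (Y' w))%:E = 0)%E.

(** The differences of the two pairs solve one homogeneous linear system and vanish at 0; parity
    reduces to [xi >= 0]. *)
Lemma same_waves (xi : R) : Ecos Y xi = Ecos Y' xi /\ Esin Y xi = Esin Y' xi.
Proof.
wlog xi0 : xi / 0 <= xi.
  move=> h; have [/h//|xi0] := leP 0 xi.
  have [] := h (- xi); first by rewrite oppr_ge0 ltW.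
  by rewrite !Ecos_opp !Esin_opp // => -> /oppr_inj ->.
pose S := symbolB alpha * symbolA_conj alpha.
have du (x : R) : is_derive x (1 : R) (fun x => Ecos Y x - Ecos Y' x)
  (wave_sin S x / symbol_abs alpha x * (Ecos Y x - Ecos Y' x)
   - wave_cos S x / symbol_abs alpha x * (Esin Y x - Esin Y' x)).
  apply: (@is_derive_eq _ _ _ _ _ _ _ _
    (is_deriveB (Ecos_ode intY steinY x) (Ecos_ode intY' steinY' x))).
  by rewrite -/S; ring.
have dv (x : R) : is_derive x (1 : R) (fun x => Esin Y x - Esin Y' x)
  (wave_cos S x / symbol_abs alpha x * (Ecos Y x - Ecos Y' x)
   + wave_sin S x / symbol_abs alpha x * (Esin Y x - Esin Y' x)).
  apply: (@is_derive_eq _ _ _ _ _ _ _ _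
    (is_deriveB (Esin_ode intY steinY x) (Esin_ode intY' steinY' x))).
  by rewrite -/S; ring.
(* The denominator is at least 1, so the bound of [wave_sin S] on [0, xi] also bounds the
   quotient. *)
have [] := rotation_ode_unique (K := wave_bound S xi) xi0 du dv.
- by rewrite !Ecos0 subrr.
- by rewrite !Esin0 subrr.
- move=> x /andP[x0 xM]; apply: le_trans (ler_norm _) _.
  have s1 := symbol_abs_ge1 alpha x.
  rewrite normrM normfV (ger0_norm (le_trans ler01 s1)) ler_pdivrMr ?(lt_le_trans ltr01) //.
  apply: (le_trans (wave_sin_bound S (_ : `|x| <= xi))); first by rewrite ger0_norm.
  by rewrite ler_peMr // sumr_ge0 // => k _; rewrite mulr_ge0 // exprn_ge0.
by move=> /eqP; rewrite subr_eq0 => /eqP -> /eqP; rewrite subr_eq0 => /eqP ->.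
Qed.

End same_waves.

(** * Inversion with the Cauchy kernel *)

Section cauchy_kernel.
Context (R : realType).
Notation mu := (@lebesgue_measure R).

(** The density [eps exp(- eps x)] normalises the kernel to 1 at [y = 0]. *)
Lemma laplace_cos (eps y : R) : 0 < eps ->
  (\int[mu]_x (exponential_pdf eps x * cos (x * y))%:E = (eps ^+ 2 /
    (eps ^+ 2 + y ^+ 2))%:E)%E.
Proof.
move=> e0; pose D := eps ^+ 2 + y ^+ 2.
have D0 : 0 < D by rewrite /D ltr_pwDl ?exprn_gt0 ?sqr_ge0.
pose k x := eps * expR (- eps * x) * cos (x * y).
have ck : continuous k.
  apply: continuous_mul; last first.
    by have := @continuous_affine_comp _ (@cos R) y 0 (@continuous_cos R);
      under eq_fun do rewrite addr0 mulrC.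
  apply: continuous_mul; first exact: continuous_const.
  by have := @continuous_affine_comp _ (@expR R) (- eps) 0 (@continuous_expR R);
      under eq_fun do rewrite addr0.
have restr x : exponential_pdf eps x * cos (x * y) = (k \_ `[0%R, +oo[) x.
  by rewrite /exponential_pdf !patchE; case: ifP => // _; rewrite mul0r.
have mpdf := measurable_exponential_pdf eps.
have mcos : measurable_fun setT (fun x : R => cos (x * y)).
  apply: continuous_measurable.
  by have := @continuous_affine_comp _ (@cos R) y 0 (@continuous_cos R);
      under eq_fun do rewrite addr0 mulrC.
have intk : mu.-integrable `[0%R, +oo[ (EFin \o k).
  have : mu.-integrable setT (EFin \o (fun x => exponential_pdf eps x * cos (x * y))).
    apply: le_integrable (integrable_exponential_pdf e0) => //.
      by apply/measurable_EFinP; apply: measurable_funM.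
    by move=> x _ /=; rewrite lee_fin normrM ler_piMr // cos_max.
  move=> h; have : mu.-integrable `[0%R, +oo[ (EFin \o (fun x =>
    exponential_pdf eps x * cos (x * y))).
    exact: (integrableS measurableT _ (@subsetT _ _) h).
  by apply: eq_integrable => // x xin; rewrite /= restr patchE xin.
(* Explicit antiderivative of [k]: it tends to 0 at infinity and equals [- eps^2 / D] at 0. *)
pose H x := eps / D * (expR (- eps * x + 0) * (y * sin (y * x + 0) + - eps * cos
  (y * x + 0))).
have dH (x : R) : is_derive x (1 : R) H (k x).
  have de := is_derive1_comp (is_derive_expR _) (is_derive_affine (- eps) 0 x).
  have ds := is_derive1_comp (is_derive_sin _) (is_derive_affine y 0 x).
  have dc := is_derive1_comp (is_derive_cos _) (is_derive_affine y 0 x).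
  apply: (@is_derive_eq _ _ _ _ _ _ _ _ (is_derive_scale (eps / D)
    (is_derive_mul de (is_derive_add (is_derive_scale y ds) (is_derive_scale
      (- eps) dc))))).
  rewrite /k /= !addr0 [x * y]mulrC /D; field.
  by rewrite gt_eqF.
have Hy : H x @[x --> +oo] --> 0.
  pose C := eps / D * (`|y| + eps).
  have h0 : C * expR (- (eps * x)) @[x --> +oo] --> 0.
    rewrite -[X in _ --> X](mulr0 C); apply: cvgM; first exact: cvg_cst.
    apply: (@cvg_comp _ _ _ (fun z => eps * z) (fun z => expR (- z)) _ (pinfty_nbhs R)).
      exact: gt0_cvgMry.
    exact: cvgr_expR.
  apply: norm_cvg0; apply: (@squeeze_cvgr _ _ _ _ (cst 0) _ _ _ _ _ h0);
    last exact: cvg_cst.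
  apply: nearW => x; rewrite /= normr_ge0 /= /H normrM (ger0_norm (_ : 0 <= eps / D));
    last by rewrite divr_ge0 // ltW.
  rewrite /C -[leRHS]mulrA ler_wpM2l //; first by rewrite divr_ge0 // ltW.
  rewrite normrM (ger0_norm (expR_ge0 _)) [leRHS]mulrC -mulNr addr0 ler_wpM2l ?expR_ge0 //.
  apply: (le_trans (ler_normD _ _)); rewrite !normrM normrN (gtr0_norm e0) lerD //.
    by rewrite ler_piMr // sin_max.
  by rewrite ler_piMr ?cos_max // ltW.
have := FTC_halfline dH ck intk Hy.
rewrite integral_mkcond => h; transitivity (\int[mu]_x ((EFin \o k) \_ `[0%R, +oo[) x)%E.
  by apply: eq_integral => x _; rewrite restr !patchE; case: ifP.
rewrite h; congr EFin; rewrite /H !mulr0 !addr0 expR0 sin0 cos0.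
rewrite -/D; field; by rewrite gt_eqF.
Qed.

Context (d : measure_display) (T : measurableType d) (P : probability T R)
  (Y : {RV P >-> R}).

(** For [eps > 0], [pi * eps] times the Poisson integral of the law of [Y] at height [eps] above
    [x]. *)
Definition poisson_mean (eps x : R) := \int[P]_w (eps ^+ 2 / (eps ^+ 2 + (Y w - x) ^+ 2)).

(** Fubini applied to [laplace_cos] at [Y - x]; it shows that this mean depends on the law only
    through [Ecos] and [Esin]. *)
Lemma poisson_meanE (eps x : R) : 0 < eps ->
  poisson_mean eps x =
  \int[mu]_xi (exponential_pdf eps xi * (cos (xi * x) * Ecos Y xi + sin
    (xi * x) * Esin Y xi)).
Proof.
move=> e0.
pose f (z : measurableTypeR R * T) := (exponential_pdf eps z.1 * cos (z.1 *
  (Y z.2 - x)))%:E.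
have pdf0 z : 0 <= exponential_pdf eps z by apply: exponential_pdf_ge0; exact: ltW.
have mf : measurable_fun setT f.
  apply/measurable_EFinP; apply: measurable_funM.
    by apply: measurableT_comp; [exact: measurable_exponential_pdf|exact: measurable_fst].
  apply: (measurableT_comp (f := @cos R)).
    by apply: continuous_measurable; exact: continuous_cos.
  apply: measurable_funM; first exact: measurable_fst.
  apply: measurable_funB => //.
  by apply: measurableT_comp; [exact: measurable_funP|exact: measurable_snd].
have intf : (mu \x P)%E.-integrable setT f.
  apply/integrable12ltyP => //.
  apply: (@le_lt_trans _ _ (\int[mu]_z (exponential_pdf eps z)%:E)%E); last first.
    by rewrite integral_exponential_pdf // ltry.
  apply: ge0_le_integral => //.
  - by move=> z _; apply: integral_ge0.
  - apply: (@measurable_fun_fubini_tonelli_F _ _ _ _ _ P (abse \o f)) => //.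
    by apply: (measurableT_comp _ mf); exact: abse_measurable.
  - by move=> z; exact: abse_ge0.
  - by apply/measurable_EFinP; exact: measurable_exponential_pdf.
  - move=> z _.
    apply: (@le_trans _ _ (\int[P]_w (exponential_pdf eps z)%:E)%E).
      apply: ge0_le_integral => //.
      + by apply: measurableT_comp => //; apply: (measurableT_comp mf);
        exact: pair1_measurable.
      + by move=> w _; rewrite /f /= lee_fin normrM (ger0_norm
        (pdf0 _)) ler_piMr // cos_max.
    rewrite integral_cst // [X in (_ * X)%E](_ : _ = 1%E) ?mule1 //;
      exact: probability_setT.
have iC c (h : R -> R) : continuous h -> (forall x, `|h x| <= 1) ->
    P.-integrable setT (EFin \o (fun w => h (c * Y w))).
  move=> ch hh; have := integrable_affine_comp Y c 0 ch hh.
  by apply: eq_integrable => // w _ /=; rewrite addr0.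
have iZ (a : R) (g : T -> R) : P.-integrable setT (EFin \o g) -> P.-integrable setT
  (EFin \o (fun w => a * g w)).
  by move=> hg; apply: eq_integrable (integrableZl measurableT a hg).
have icos xi := iC xi _ (@continuous_cos R) (fun x => cos_max x).
have isin xi := iC xi _ (@continuous_sin R) (fun x => sin_max x).
have cosE xi w : cos (xi * (Y w - x)) = cos (xi * x) * cos (xi * Y w) + sin (xi * x) * sin
  (xi * Y w).
  by rewrite mulrBr cosB; ring.
rewrite /poisson_mean /Rintegral; congr fine.
transitivity (\int[P]_w \int[mu]_xi f (xi, w))%E.
  by apply: eq_integral => w _; rewrite /f /= laplace_cos.
rewrite -(Fubini intf); apply: eq_integral => xi _.
have ixi : P.-integrable setT (EFin \o (fun w => exponential_pdf eps xi * cos (xi *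
  (Y w - x)))).
  apply: (iZ); apply: eq_integrable (integrableD measurableT (iZ (cos (xi * x)) _
    (icos xi)) (iZ (sin (xi * x)) _ (isin xi))) => // w _.
  by rewrite /= cosE EFinD.
rewrite -[LHS]fineK; last exact: integrable_fin_num ixi.
congr EFin; rewrite -/(Rintegral _ _ (fun w => exponential_pdf eps xi * cos (xi *
  (Y w - x)))).
under eq_Rintegral do rewrite cosE.
rewrite RintegralZl //; last by apply: eq_integrable (integrableD measurableT (iZ (cos
  (xi * x)) _ (icos xi)) (iZ (sin (xi * x)) _ (isin xi))).
rewrite RintegralD //; [|exact: iZ|exact: iZ].
by rewrite !RintegralZl.
Qed.

End cauchy_kernel.

(** * From the Cauchy kernel to the distribution function *)

Section atan_expectation.
Context (R : realType) (d : measure_display) (T : measurableType d) (P : probability T R)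
  (Y : {RV P >-> R}).

Lemma bounded_cvg_Rintegral (f_ : nat -> T -> R) (f : T -> R) (C : R) :
  (forall n, measurable_fun setT (f_ n)) -> measurable_fun setT f ->
  (forall n w, `|f_ n w| <= C) -> (forall w, f_ n w @[n --> \oo] --> f w) ->
  \int[P]_w f_ n w @[n --> \oo] --> \int[P]_w f w.
Proof.
move=> mf_ mf hC hf.
have iC : P.-integrable setT (EFin \o cst C) by exact: finite_measure_integrable_cst.
have [] := @dominated_convergence _ _ _ P setT measurableT
  (fun n => EFin \o f_ n) (EFin \o f) (EFin \o cst C).
- by move=> n; apply/measurable_EFinP.
- exact/measurable_EFinP.
- apply: aeW => w _; apply: cvg_EFin; [exact: nearW|exact: hf].
- exact: iC.
- by apply: aeW => w n _ /=; rewrite lee_fin.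
move=> intf _ h; apply: fine_cvg; rewrite fineK //.
exact: integrable_fin_num.
Qed.

Lemma atan_bound (x : R) : `|atan x| <= pi / 2.
Proof.
rewrite ler_norml; have := atan_ltpi2 x; have := atan_gtNpi2 x; lra.
Qed.

Definition Eatan (eps x : R) := \int[P]_w atan (eps^-1 * (Y w - x)).

Lemma is_derive_Eatan eps x : 0 < eps ->
  is_derive x (1 : R) (Eatan eps) (- eps^-1 * poisson_mean Y eps x).
Proof.
move=> e0.
have e1 : eps != 0 by rewrite gt_eqF.
have D0 (z : R) : 0 < eps ^+ 2 + z ^+ 2 by rewrite ltr_pwDl ?exprn_gt0 ?sqr_ge0.
have mY : measurable_fun setT Y by exact: measurable_funP.
have le1 y w : `|eps ^+ 2 / (eps ^+ 2 + (Y w - y) ^+ 2)| <= 1.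
  rewrite ger0_norm ?divr_ge0 ?sqr_ge0 ?(ltW (D0 _)) // ler_pdivrMr // mul1r lerDl.
  exact: sqr_ge0.
pose df (y : R) (w : T) := - eps^-1 * (eps ^+ 2 / (eps ^+ 2 + (Y w - y) ^+ 2)).
have := @is_derive_expectation _ _ _ P (fun y w => atan (eps^-1 * (Y w - y))) df (fun=>
  eps^-1) x.
have -> : \int[P]_w df x w = - eps^-1 * poisson_mean Y eps x.
  rewrite RintegralZl //; apply: (@bounded_integrable _ _ _ _ _ 1) => //.
  apply: (@measurable_RV_comp _ _ _ _ Y (fun z => eps ^+ 2 / (eps ^+ 2 + (z - x) ^+ 2))).
  have c1 : continuous (fun z : R => eps ^+ 2 + (z - x) ^+ 2).
    apply: continuous_add; first exact: continuous_const.
    apply: continuous_square; apply: continuous_add; last exact: continuous_const.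
    by move=> z; exact: cvg_id.
  apply: continuous_mul; first exact: continuous_const.
  by move=> z; apply: cvgV; [rewrite gt_eqF|exact: c1].
apply.
- move=> y; apply: (@bounded_integrable _ _ _ _ _ (pi / 2)); last by move=> w;
  exact: atan_bound.
  apply: (measurableT_comp (f := @atan R)).
    by apply: continuous_measurable; exact: continuous_atan.
  by apply: measurable_funM => //; exact: measurable_funB.
- move=> y w; have e : (fun y => atan (eps^-1 * (Y w - y))) = @atan R \o (fun y =>
  - eps^-1 * y + eps^-1 * Y w).
    by apply/funext => z /=; congr atan; ring.
  rewrite e; apply: (@is_derive_eq _ _ _ _ _ _ _ _ (is_derive1_comp (is_derive1_atan _)
    (is_derive_affine (- eps^-1) (eps^-1 * Y w) y))).
  have h0 : eps ^+ 2 + (Y w - y) ^+ 2 != 0 by rewrite gt_eqF.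
  have -> : 1 + (- eps^-1 * y + eps^-1 * Y w) ^+ 2 = (eps ^+ 2 +
    (Y w - y) ^+ 2) / eps ^+ 2 by field.
  by rewrite /df invf_div mulrC.
- by apply: finite_measure_integrable_cst.
- move=> y w; rewrite /df normrM normrN (@ger0_norm _ eps^-1) ?invr_ge0 ?(ltW e0) //.
  by rewrite ler_piMr // invr_ge0 ltW.
Qed.

Lemma measurable_atan_RV (a b : R) : measurable_fun setT (fun w => atan (a * (Y w - b))).
Proof.
apply: (measurableT_comp (f := @atan R)).
  by apply: continuous_measurable; exact: continuous_atan.
by apply: measurable_funM => //; apply: measurable_funB => //; exact: measurable_funP.
Qed.

(** The limit at minus infinity, common to all laws, fixes the constant of integration in
    [same_Eatan]. *)
Lemma cvg_Eatan eps : 0 < eps -> Eatan eps (- n%:R) @[n --> \oo] --> (pi / 2 : R).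
Proof.
move=> e0; have -> : (pi / 2 : R) = \int[P]_w (pi / 2).
  by rewrite Rintegral_cst // [X in _ * fine X](_ : _ = 1%E) ?mulr1 //;
    exact: probability_setT.
apply: (bounded_cvg_Rintegral (C := pi / 2)) => //.
- by move=> n; exact: measurable_atan_RV.
- by move=> n w; exact: atan_bound.
- move=> w; apply: (@cvg_comp _ _ _ (fun n => eps^-1 * (Y w - - n%:R)) (@atan R) _
  (pinfty_nbhs R)); last exact: cvgy_atan.
  apply/cvgryPge => A; near=> n; rewrite opprK mulrC ler_pdivlMr // -lerBlDl.
  near: n; exact: nbhs_infty_ger.
Unshelve. all: by end_near. Qed.

(** With [m = n + 1], the argument of [atan] is [m^2 (Y - x) + m]. The shift by [1 / m] is large
    compared with [eps = 1 / m^2], so an atom at [x] goes to the [pi / 2] side and the limit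
    involves exactly [Y < x]. *)
Lemma cvg_Eatan_lt x : Eatan (n.+1%:R ^- 2) (x - n.+1%:R^-1) @[n --> \oo] -->
  pi / 2 - pi * fine (P [set w | Y w < x]).
Proof.
have mlt : measurable [set w | Y w < x].
  have -> : [set w | Y w < x] = Y @^-1` `]-oo, x[ by apply/seteqP; split=> w /=;
    rewrite in_itv.
  by rewrite -[X in measurable X]setTI; exact: measurable_funP.
have -> : pi / 2 - pi * fine (P [set w | Y w < x])
    = \int[P]_w (pi / 2 - pi * \1_[set w | Y w < x] w).
  have i1 : P.-integrable setT (EFin \o (\1_[set w | Y w < x] : T -> R)) by exact:
    integrable_indic.
  have i2 : P.-integrable setT (EFin \o (fun w => pi * \1_[set w | Y w < x] w)).
    exact: eq_integrable (integrableZl measurableT pi i1).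
  rewrite RintegralB //; last by exact: finite_measure_integrable_cst.
  rewrite Rintegral_cst // RintegralZl // /Rintegral integral_indic // setIT.
  by rewrite [X in _ * fine X - _](_ : _ = 1%E) ?mulr1 //; exact: probability_setT.
apply: (bounded_cvg_Rintegral (C := pi / 2)) => //.
- by move=> n; exact: measurable_atan_RV.
- by apply: measurable_funB => //; apply: measurable_funM => //; exact: measurable_indic.
- by move=> n w; exact: atan_bound.
- move=> w; rewrite indicE.
  have e n : (n.+1%:R ^- 2)^-1 * (Y w - (x - n.+1%:R^-1)) = n.+1%:R * (n.+1%:R *
    (Y w - x) + 1).
    by rewrite invrK; field.
  have [lt|ge] := ltP (Y w) x.
    rewrite mem_set // mulr1 (_ : pi / 2 - pi = - (pi / 2)); last by field.
    have -> : (fun n : nat => atan ((n.+1%:R ^- 2)^-1 * (Y w - (x - n.+1%:R^-1))))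
       = (fun n : nat => - atan (n.+1%:R * (n.+1%:R * (x - Y w) - 1))).
      by apply/funext => n; rewrite e -atanN; congr atan; ring.
    apply: cvgN; apply: (@cvg_comp _ _ _ _ (@atan R) _ (pinfty_nbhs R));
      last exact: cvgy_atan.
    have d0 : 0 < x - Y w by rewrite subr_gt0.
    apply/cvgryPge => A; near=> n.
    have n0 : A <= n.+1%:R.
      rewrite (@le_trans _ _ n%:R) // ?ler_nat //; near: n; exact: nbhs_infty_ger.
    (* It makes the inner factor [(n + 1) (x - Y) - 1] at least 1, so the product is at least
       [n + 1]. *)
    have n1 : 2 / (x - Y w) <= n.+1%:R.
      rewrite (@le_trans _ _ n%:R) // ?ler_nat //; near: n; exact: nbhs_infty_ger.
    apply: (le_trans n0); rewrite ler_peMr //.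
    by move: n1; rewrite ler_pdivrMr //; lra.
  rewrite memNset ?mulr0 ?subr0; last by rewrite /= ltNge ge.
  apply: (@cvg_comp _ _ _ _ (@atan R) _ (pinfty_nbhs R)); last exact: cvgy_atan.
  apply/cvgryPge => A; near=> n; rewrite e.
  have n0 : A <= n.+1%:R.
    rewrite (@le_trans _ _ n%:R) // ?ler_nat //; near: n; exact: nbhs_infty_ger.
  apply: (le_trans n0); rewrite ler_peMr // lerDr mulr_ge0 // subr_ge0 //.
Unshelve. all: by end_near. Qed.

End atan_expectation.

Section same_law.
Context (R : realType).
Context (d : measure_display) (T : measurableType d) (P : probability T R)
  (Y : {RV P >-> R}).
Context (d' : measure_display) (T' : measurableType d') (P' : probability T' R)
  (Y' : {RV P' >-> R}).
Hypothesis same_waves : forall xi, Ecos Y xi = Ecos Y' xi /\ Esin Y xi = Esin Y' xi.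

(** Equal Poisson means give equal derivatives in [x], so the difference is constant; it tends to 0
    at minus infinity. *)
Lemma same_Eatan eps x : 0 < eps -> Eatan Y eps x = Eatan Y' eps x.
Proof.
move=> e0; apply/eqP; rewrite -subr_eq0; apply/eqP.
have pm z : poisson_mean Y eps z = poisson_mean Y' eps z.
  rewrite !poisson_meanE //; apply: eq_Rintegral => xi _.
  by have [-> ->] := same_waves xi.
have dD (z : R) : is_derive z (1 : R) (fun z => Eatan Y eps z - Eatan Y' eps z) 0.
  apply: (@is_derive_eq _ _ _ _ _ _ _ _
    (is_deriveB (is_derive_Eatan Y z e0) (is_derive_Eatan Y' z e0))).
  by rewrite pm subrr.
have h : Eatan Y eps (- n%:R) - Eatan Y' eps (- n%:R) @[n --> \oo] --> pi / 2 - pi / 2.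
  by apply: cvgB; exact: cvg_Eatan.
rewrite subrr in h.
have e n : Eatan Y eps (- n%:R) - Eatan Y' eps (- n%:R) = Eatan Y eps x - Eatan Y' eps x.
  exact: (is_derive_0_is_cst _ _ dD).
move: h; under eq_fun do rewrite e; move=> h.
exact: (cvg_unique _ (cvg_cst _) h).
Qed.

Lemma same_cdf x : P [set w | Y w < x] = P' [set w | Y' w < x].
Proof.
have h1 := @cvg_Eatan_lt _ _ _ P Y x; have h2 := @cvg_Eatan_lt _ _ _ P' Y' x.
have e : (fun n => Eatan Y (n.+1%:R ^- 2) (x - n.+1%:R^-1)) =
   (fun n => Eatan Y' (n.+1%:R ^- 2) (x - n.+1%:R^-1)).
  by apply/funext => n; apply: same_Eatan; rewrite invr_gt0 exprn_gt0.
rewrite e in h1.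
have h0 : pi / 2 - pi * fine (P [set w | Y w < x]) = pi / 2 - pi * fine
  (P' [set w | Y' w < x]).
  exact: (cvg_unique (@Rhausdorff R) h1 h2).
have h : fine (P [set w | Y w < x]) = fine (P' [set w | Y' w < x]).
  by apply: (mulfI (lt0r_neq0 (pi_gt0 R))); move: h0; lra.
have m (dd : measure_display) (TT : measurableType dd) (Q : probability TT R)
  (Z : {RV Q >-> R}) :
   measurable [set w | Z w < x].
  have -> : [set w | Z w < x] = Z @^-1` `]-oo, x[ by apply/seteqP; split=> w /=;
    rewrite in_itv.
  by rewrite -[X in measurable X]setTI; exact: measurable_funP.
by rewrite -[LHS]fineK ?fin_num_measure // -[RHS]fineK ?fin_num_measure // h.
Qed.

(** Open left rays are stable under intersection, cover the line and generate the Borel sets. *)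
Lemma same_law (B : set R) : measurable B -> distribution P Y B = distribution P' Y' B.
Proof.
apply: (measure_unique (@RGenInftyO.G R) (fun k => `]-oo, k%:R[%classic)).
- exact: RGenInftyO.measurableE.
- move=> _ _ [a ->] [b ->]; exists (Num.min a b).
  apply/seteqP; split => z; rewrite /= !in_itv /= lt_min; first by case=> -> ->.
  by case/andP.
- by move=> k; exists k%:R.
- apply/seteqP; split => // z _.
  by exists (Num.bound `|z|) => //; rewrite /= in_itv /= (le_lt_trans
    (ler_norm _)) // archi_boundP.
- move=> _ [x ->]; have := same_cdf x.
  have e (TT : Type) (Z : TT -> R) : Z @^-1` `]-oo, x[ = [set w | Z w < x].
    by apply/seteqP; split => w; rewrite /= in_itv.
  by rewrite -(e T Y) -(e T' Y').
- by move=> k; rewrite -ge0_fin_numE // fin_num_measure.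
Qed.

End same_law.

(** * The characterization *)

Section transfer.
Context (R : realType) (q : nat) (alpha : 'I_q -> R).
Context (d : measure_display) (T : measurableType d) (P : probability T R)
  (Y : {RV P >-> R}).

Definition stein_core (f : R -> R) (x : R) : R :=
  dop (symbolB alpha) f x - x * dop (symbolA alpha) f x.

Lemma measurable_stein_core f : Ck q f -> measurable_fun setT (stein_core f).
Proof.
move=> hf; apply: measurable_funB.
  by apply: continuous_measurable; exact: dop_continuous hf (size_symbolB _).
apply: measurable_funM => //.
by apply: continuous_measurable; exact: dop_continuous hf (size_symbolA _).
Qed.

Lemma integral_half_power (g : T -> R) : P.-integrable setT (EFin \o g) ->
  (\int[P]_w (2 ^- q * g w)%:E = 0)%E <-> (\int[P]_w (g w)%:E = 0)%E.
Proof.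
move=> hg; have -> : (\int[P]_w (2 ^- q * g w)%:E = (2 ^- q)%:E * \int[P]_w (g w)%:E)%E.
  by rewrite -integralZl //; apply: eq_integral => w _; rewrite EFinM.
split=> [/eqP|->]; last by rewrite mule0.
by rewrite mule_eq0 eqe invr_eq0 expf_eq0 pnatr_eq0 andbF /= => /eqP.
Qed.

(** Bounded derivatives make [stein_core f] grow at most linearly, so the majorant is affine in
    [|Y|]. *)
Lemma bounded_stein_core f : P.-integrable setT (EFin \o Y) -> Ck q f ->
  bounded_derivatives q f -> P.-integrable setT (EFin \o (fun w => stein_core f (Y w))).
Proof.
move=> intY hf [C hC].
have C0 : 0 <= C by exact: le_trans (hC 0 0 (leq0n q)).
pose b (p : {poly R}) := \sum_(k < size p) `|p`_k| * C.
have b0 p : 0 <= b p by apply: sumr_ge0 => k _; exact: mulr_ge0.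
have hb (p : {poly R}) (x : R) : (size p <= q.+1)%N -> `|dop p f x| <= b p.
  move=> hp; apply: (le_trans (ler_norm_sum _ _ _)); apply: ler_sum => k _.
  by rewrite normrM ler_wpM2l // hC // -ltnS (leq_trans (ltn_ord k)).
have iC : P.-integrable setT (EFin \o cst (b (symbolB alpha))) by exact:
  finite_measure_integrable_cst.
have iA : P.-integrable setT (EFin \o (fun w => b (symbolA alpha) * `|Y w|)).
  by apply: eq_integrable (integrableZl measurableT (b (symbolA alpha))
    (integrable_norm intY)) => // w _; rewrite /= EFinM.
apply: le_integrable (integrableD measurableT iC iA) => //.
  apply/measurable_EFinP; apply: measurableT_comp; first exact: measurable_stein_core.
  exact: measurable_funP.
move=> w _ /=; rewrite lee_fin [leRHS]ger0_norm ?addr_ge0 ?mulr_ge0 //.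
apply: (le_trans (ler_normB _ _)); rewrite lerD ?hb ?size_symbolB // normrM mulrC.
by rewrite ler_wpM2r // hb // size_symbolA.
Qed.

Lemma bounded_derivatives_L2 f : Ck q f -> bounded_derivatives q f ->
  (\int[P]_w (derive1n q f (Y w) ^+ 2)%:E < +oo)%E.
Proof.
move=> hf [C hC].
apply: (@le_lt_trans _ _ (\int[P]_w cst (C ^+ 2)%:E w)%E); last first.
  rewrite integral_cst // [X in (_ * X)%E](_ : _ = 1%E) ?mule1 ?ltry //.
  exact: probability_setT.
apply: ge0_le_integral => //.
- by move=> w _; rewrite lee_fin sqr_ge0.
- apply/measurable_EFinP.
  apply: (@measurable_RV_comp _ _ _ _ _ (fun x => derive1n q f x ^+ 2)).
  by apply: continuous_square; case: hf.
- move=> w _; rewrite lee_fin -(real_normK (num_real (derive1n q f _))).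
  by rewrite lerXn2r ?nnegrE ?hC // (le_trans _ (hC q 0 (leqnn q))).
Qed.

End transfer.

Theorem theorem2p2 (R : realType)
  (* the limit law *)
  (q : nat) (hq : (2 <= q)%N)
  (alpha : 'I_q -> R) (halpha : injective alpha)
  (d' : measure_display) (T' : measurableType d') (P' : probability T' R)
  (N : 'I_q -> {RV P' >-> R}) (hN : iid_std_normal N)
  (* the isonormal Gaussian process *)
  (H : completeNormedModType R) (dot : {dot H for idfun})
  (hH : separable_hilbert dot)
  (d : measure_display) (T : measurableType d) (P : probability T R)
  (X : H -> {RV P >-> R}) (hX : isonormal dot X)
  (F : {RV P >-> R}) (hF : in_finite_chaos X F) (hF0 : ('E_P[F] = 0)%E) :
  let A := stein_op alpha (cumulant P' (quad_target alpha N)) in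
  (forall B : set R, measurable B ->
     distribution P F B = distribution P' (quad_target alpha N) B) <->
  (forall f : R -> R, Ck q f ->
     ('E_P[fun w => `|A f (F w)|%R] < +oo)%E ->
     ('E_P[fun w => (derive1n q f (F w) ^+ 2)%R] < +oo)%E ->
     ('E_P[fun w => A f (F w)] = 0)%E).
Proof.
move=> A.
have q0 : (0 < q)%N by exact: leq_trans hq.
pose Z : {RV P' >-> R} := quad_target alpha N.
have AE f x : A f x = 2 ^- q * stein_core alpha f x.
  by apply: stein_opE => m; exact: cumulant_target.
have mF : measurable_fun setT F by exact: measurable_funP.
(* For a measurable function the extended integral is infinite whenever that of the absolute value
   is, because [+oo - oo] is [-oo]. A zero mean therefore implies integrability. *)
have intF : P.-integrable setT (EFin \o F).
  apply/integrableP; split; first exact/measurable_EFinP.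
  apply/abse_integralP => //; first exact/measurable_EFinP.
  by move: hF0; rewrite unlock => ->; rewrite abse0 ltry.
have intZ : P'.-integrable setT (EFin \o Z) by exact: integrable_target.
have mA f : Ck q f -> measurable_fun setT (A f).
  move=> hf; have -> : A f = (fun x => 2 ^- q * stein_core alpha f x).
    by apply/funext => x; exact: AE.
  by apply: measurable_funM => //; exact: measurable_stein_core.
split=> [law f hf|stein B mB].
- rewrite unlock => hA hL2.
  (* Equality of laws carries both moment conditions from [F] to the target, where the identity is
     established. *)
  have transfer (g : R -> \bar R) : measurable_fun setT g -> (forall x, 0 <= g x)%E ->
      (\int[P']_w g (Z w) = \int[P]_w g (F w))%E.
    move=> mg g0; rewrite -(ge0_integral_distribution Z mg g0) -(ge0_integral_distribution
      F mg g0).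
    by apply: eq_measure_integral => B mB _; exact/esym/law.
  have {}hL2 : (\int[P']_w (derive1n q f (Z w) ^+ 2)%:E < +oo)%E.
    rewrite (transfer (fun x => (derive1n q f x ^+ 2)%:E)) //.
      by apply/measurable_EFinP; apply: continuous_measurable; apply: continuous_square;
        case: hf.
    by move=> x; rewrite lee_fin sqr_ge0.
  have mAE : measurable_fun setT (EFin \o A f) by apply/measurable_EFinP; exact: mA.
  have mabs : measurable_fun setT (fun x => (`|A f x|)%:E).
    by apply/measurable_EFinP; apply: measurableT_comp => //; exact: mA.
  have iAF : P.-integrable setT ((EFin \o A f) \o F).
    by apply/integrableP; split => //; exact: measurableT_comp.
  have iAZ : P'.-integrable setT ((EFin \o A f) \o Z).
    apply/integrableP; split; first exact: measurableT_comp.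
    by rewrite (transfer (fun x => (`|A f x|)%:E)).
  transitivity (\int[P']_w ((EFin \o A f) \o Z) w)%E.
    rewrite -(integral_distribution mAE iAZ).
    rewrite -[LHS](integral_distribution mAE iAF).
    by apply: eq_measure_integral => B mB _; exact: law.
  have iS : P'.-integrable setT (EFin \o (fun w => stein_core alpha f (Z w))).
    apply: eq_integrable (integrableZl measurableT (2 ^+ q) iAZ) => // w _ /=.
    by rewrite AE -EFinM mulrA divff ?mul1r // expf_neq0 // pnatr_eq0.
  have /(integral_half_power q iS) := stein_identity hN q0 hf hL2.
  by move=> <-; apply: eq_integral => w _ /=; rewrite AE.
(* For these test functions integrability of [F] yields both moment conditions, so the hypothesis
   applies. *)
- have steinF f : Ck q f -> bounded_derivatives q f ->
    (\int[P]_w (dop (symbolB alpha) f (F w) - F w * dop (symbolA alpha) f (F w))%:E = 0)%E.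
    move=> hf hb; have i1 := bounded_stein_core alpha intF hf hb.
    apply/(integral_half_power q i1).
    have iA : P.-integrable setT (EFin \o (fun w => A f (F w))).
      apply: eq_integrable (integrableZl measurableT (2 ^- q) i1) => // w _ /=.
      by rewrite AE.
    have := stein f hf; rewrite unlock => h.
    rewrite -[RHS]h.
    + by apply: eq_integral => w _; rewrite AE.
    + by have /integrableP[_] := iA.
    + exact: bounded_derivatives_L2 hf hb.
  have steinZ f : Ck q f -> bounded_derivatives q f ->
    (\int[P']_w (dop (symbolB alpha) f (Z w) - Z w * dop (symbolA alpha) f (Z w))%:E = 0)%E.
    by move=> hf hb; apply: stein_identity => //; exact: bounded_derivatives_L2 hf hb.
  exact: (same_law (same_waves intF intZ steinF steinZ) mB).
Qed.
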